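(* In the setting of the context (translation invariant systems on periodic hypercubic lattices $\Lambda$ with $N$ sites, with long range order of $O_\Lambda$ in the ground state and a uniform gap above the two lowest eigenvalues), let $$\Psi_\Lambda:=\frac{O_\Lambda\Phi^{(0)}_\Lambda}{\|O_\Lambda\Phi^{(0)}_\Lambda\|},\qquad \Xi_\Lambda:=\frac1{\sqrt2}\left(\Phi^{(0)}_\Lambda+\Psi_\Lambda\right).$$ Then the infinite volume state $$\omega_+(\cdots)=\lim_{N\uparrow\infty}(\Xi_\Lambda,(\cdots)\,\Xi_\Lambda),$$ defined by taking a suitable subsequence so that the limit exists for every local operator, is an ergodic translation invariant ground state.
   Context: $\Lambda$ ranges over $d$-dimensional hypercubic lattices with $N$ sites and periodic boundary conditions, tending to $\mathbf Z^d$. To each site $x$ is associated a copy $\mathcal H_x$ of a fixed finite-dimensional Hilbert space; $\mathcal H_\Lambda=\bigotimes_{x\in\Lambda}\mathcal H_x$. $\tau_x$ is translation of operators by $x$ (respecting periodicity on $\Lambda$). $H_\Lambda=\sum_{x\in\Lambda}h_x$ and $O_\Lambda=\sum_{x\in\Lambda}o_x$, with $h_x=\tau_x(h_o)$ and $o_x=\tau_x(o_o)$, where $h_o$ and $o_o$ are self-adjoint, independent of $\Lambda$; $o_x$ acts only on $\mathcal H_x$, and $h_x$ acts only on $\bigotimes_{y\in\mathcal S_x}\mathcal H_y$ for a set $\mathcal S_x$ of at most $r$ sites. $\|h_x\|\le h$, $\|o_x\|\le o$. The constants $h,o>0$ and $r$ are independent of $\Lambda$. $E^{(0)}_\Lambda<E^{(1)}_\Lambda$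 are the two lowest eigenvalues of $H_\Lambda$, both nondegenerate, with normalized eigenstates $\Phi^{(0)}_\Lambda,\Phi^{(1)}_\Lambda$, and any other eigenvalue $E'_\Lambda$ satisfies $E'_\Lambda-E^{(1)}_\Lambda\ge E_{\rm G}$ with a $\Lambda$-independent constant $E_{\rm G}>0$. The ground state satisfies $$(\Phi^{(0)}_\Lambda,O_\Lambda\Phi^{(0)}_\Lambda)=0,\quad (\Phi^{(0)}_\Lambda,(O_\Lambda)^2\Phi^{(0)}_\Lambda)\ge(\mu oN)^2,\quad (\Phi^{(0)}_\Lambda,(O_\Lambda)^3\Phi^{(0)}_\Lambda)=0$$ with a $\Lambda$-independent constant $\mu>0$. A local operator is one acting nontrivially on only finitely many sites. An infinite volume state is a linear functional on local operators obtained as a pointwise limit of finite volume states. It is a ground state if $\omega(h_x)=\epsilon_0$ for all $x\in\mathbf Z^d$, where $\epsilon_0:=\lim_{\Lambda\uparrow\mathbf Z^d}\inf_{\|\Phi_\Lambda\|=1}\frac1N(\Phi_\Lambda,H_\Lambda\Phi_\Lambda)$. It is translation invariant if $\omega(\tau_x(B))=\omega(B)$ for all local $B$ and $x\in\mathbf Z^d$. A translation invariant state $\rho$ is ergodic if for every local self-adjoint $A$, with $A_\Omega:=\sum_{x\in\Omega}\tau_x(A)$, $$\lim_{|\Omega|\uparrow\infty}\frac1{|\Omega|^2}\rho\left[(A_\Omega-\rho(A_\Omega))^2\right]=0,$$ where $\Omega$ ranges over hypercubic regions in $\mathbf Z^d$ and $|\Omega|$ is the number of sites in $\Omega$. *)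

(* Defs.v *)
From HB Require Import structures.
From mathcomp Require Import all_boot all_order all_algebra.
From mathcomp Require Import finmap complex.
From mathcomp Require Import all_classical all_reals all_analysis.

Set Implicit Arguments.
Unset Strict Implicit.
Unset Printing Implicit Defensive.

Import Order.TTheory GRing.Theory Num.Theory.
Import numFieldNormedType.Exports.

Local Open Scope classical_set_scope.
Local Open Scope ring_scope.
Local Open Scope complex_scope.
Local Open Scope sesquilinear_scope.

(* The side length is l.+1, so that 'I_l.+1 is the cyclic group Z/(l+1) and
   addition on the torus respects the periodic boundary conditions. *)
Definition torus (d l : nat) := {ffun 'I_d -> 'I_l.+1}.

Definition zd (d : nat) := {ffun 'I_d -> int}.

Definition to_torus (d l : nat) (x : zd d) : torus d l :=
  [ffun i => inZp `|(x i %% l.+1%:Z)%Z|%N].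

(* With C^q on every site, the tensor product over a finite set V of sites has
   the orthonormal basis of configurations V -> 'I_q; vectors and operators are
   column vectors and matrices in this basis, numbered through enum_rank. *)
Definition config (q : nat) (V : finType) := {ffun V -> 'I_q}.

Definition vec (R : realType) (q : nat) (V : finType) :=
  'cV[R[i]]_#|{: config q V}|.

Definition op (R : realType) (q : nat) (V : finType) :=
  'M[R[i]]_#|{: config q V}|.

(* Antilinear in the first argument. *)
Definition inner (R : realType) (n : nat) (v w : 'cV[R[i]]_n) : R[i] :=
  (v ^t* *m w) 0 0.

Definition l2norm (R : realType) (n : nat) (v : 'cV[R[i]]_n) : R :=
  Num.sqrt (complex.Re (inner v v)).

Definition opnorm (R : realType) (n : nat) (A : 'M[R[i]]_n) : R :=
  sup [set l2norm (A *m v) | v in [set v : 'cV[R[i]]_n | l2norm v = 1]].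

(* For injective f, the operator A tensored with the identity, the tensor
   factor at site a of V being placed at the site f a of W.  The formula is
   total but has this meaning for injective f only. *)
Definition embed (R : realType) (q : nat) (V W : finType) (f : V -> W)
    (A : op R q V) : op R q W :=
  \matrix_(i, j)
    let s : config q W := enum_val i in
    let t : config q W := enum_val j in
    if [forall w, (w \notin codom f) ==> (s w == t w)] then
      A (enum_rank ([ffun a => s (f a)] : config q V))
        (enum_rank ([ffun a => t (f a)] : config q V))
    else 0.

Definition tau (R : realType) (d q l : nat) (x : torus d l)
    (A : op R q (torus d l)) : op R q (torus d l) :=
  embed (fun y : torus d l => x + y) A.

(* An operator on finitely many sites of Z^d, read on the torus; meaningful as
   soon as S fits into the torus, hence for all large l. *)
Definition on_torus (R : realType) (d q l : nat) (S : {fset zd d})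
    (A : op R q S) : op R q (torus d l) :=
  embed (fun y : S => to_torus l (fsval y)) A.

Definition tau_sum (R : realType) (d q l : nat) (S : {fset zd d})
    (A : op R q S) : op R q (torus d l) :=
  \sum_(x : torus d l) tau x (on_torus l A).

Definition shift (d : nat) (x : zd d) (S : {fset zd d}) : {fset zd d} :=
  [fset (x + y)%R | y in S]%fset.

Definition shift_site (d : nat) (x : zd d) (S : {fset zd d}) (y : S) :
    shift x S :=
  [` in_imfset imfset_key (fun y : zd d => (x + y)%R) (fsvalP y)]%fset.

Definition tau_loc (R : realType) (d q : nat) (x : zd d) (S : {fset zd d})
    (A : op R q S) : op R q (shift x S) :=
  embed (@shift_site d x S) A.

Definition region (d : nat) (Om S : {fset zd d}) : {fset zd d} :=
  [fset (x + y)%R | x in Om, y in S]%fset.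

Lemma shift_sub_region (d : nat) (Om S : {fset zd d}) (x : Om) :
  (shift (fsval x) S `<=` region Om S)%fset.
Proof.
apply/fsubsetP => z /imfsetP[y yS ->].
by apply: in_imfset2 => //; exact: fsvalP.
Qed.

(* The sum over x in Om of the translates of A, all of them extended by the
   identity to the common region Om + S. *)
Definition region_sum (R : realType) (d q : nat) (Om S : {fset zd d})
    (A : op R q S) : op R q (region Om S) :=
  \sum_(x : Om) embed (fincl (shift_sub_region S x)) (tau_loc (fsval x) A).

Definition cube (d : nat) (a : zd d) (m : nat) : {fset zd d} :=
  [fset (a + [ffun i => ((t : torus d m) i : nat)%:Z])%R
     | t in [set: torus d m]%SET]%fset.

(* A local operator is a finite set S of sites together with an operator on S;
   it is identified with its extensions by the identity to larger sets.  A
   functional on local operators is thus a family indexed by S, compatible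
   with these extensions. *)
Definition functional (R : realType) (d q : nat) :=
  forall S : {fset zd d}, op R q S -> R[i].

Definition local_functional (R : realType) (d q : nat)
    (omega : functional R d q) : Prop :=
  (forall S : {fset zd d}, scalar (@omega S)) /\
  (forall (S T : {fset zd d}) (ST : (S `<=` T)%fset) (A : op R q S),
      omega T (embed (fincl ST) A) = omega S A).

(* The casts to R[i]^o below select the usual topology of the complex numbers,
   which R[i] itself does not carry. *)
Definition finite_state (R : realType) (n : nat) (rho : 'M[R[i]]_n -> R[i]) :
    Prop :=
  [/\ scalar rho,
      forall A : 'M[R[i]]_n, 0 <= rho (A ^t* *m A)
    & rho 1%:M = 1].

Definition infinite_volume_state (R : realType) (d q : nat)
    (omega : functional R d q) : Prop :=
  local_functional omega /\
  exists (L : nat -> nat) (rho : forall n, op R q (torus d (L n)) -> R[i]),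
    [/\ L n @[n --> \oo] --> \oo,
        forall n, finite_state (@rho n)
      & forall (S : {fset zd d}) (A : op R q S),
          (rho n (on_torus (L n) A) : R[i]^o) @[n --> \oo]
            --> (omega S A : R[i]^o)].

Definition vector_limit (R : realType) (d q : nat) (L : nat -> nat)
    (Xi : forall n, vec R q (torus d (L n))) (omega : functional R d q) :
    Prop :=
  forall (S : {fset zd d}) (A : op R q S),
    (inner (Xi n) (on_torus (L n) A *m Xi n) : R[i]^o) @[n --> \oo]
      --> (omega S A : R[i]^o).

Definition translation_invariant (R : realType) (d q : nat)
    (omega : functional R d q) : Prop :=
  forall (x : zd d) (S : {fset zd d}) (A : op R q S),
    omega (shift x S) (tau_loc x A) = omega S A.

Definition ground_energy_density (R : realType) (d q l : nat)
    (S : {fset zd d}) (ho : op R q S) : R :=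
  inf [set #|{: torus d l}|%:R^-1
           * complex.Re (inner v (tau_sum l ho *m v))
      | v in [set v : vec R q (torus d l) | l2norm v = 1]].

(* The limit runs over all side lengths and is required to exist. *)
Definition ground_state (R : realType) (d q : nat) (S : {fset zd d})
    (ho : op R q S) (omega : functional R d q) : Prop :=
  exists2 eps0 : R,
    ground_energy_density l ho @[l --> \oo] --> eps0
  & forall x : zd d, omega (shift x S) (tau_loc x ho) = eps0%:C.

(* The limit is over all cubes with |Omega| going to infinity, uniformly in
   their position a. *)
Definition ergodic (R : realType) (d q : nat) (rho : functional R d q) :
    Prop :=
  forall (S : {fset zd d}) (A : op R q S), A \is hermsymmx ->
  forall eps : R, 0 < eps ->
  \forall m \near \oo, forall a : zd d,
    let AOm := region_sum (cube a m) A in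
    let B := AOm - (rho _ AOm)%:M in
    `| #|` cube a m|%:R ^- 2 * rho _ (B *m B) | < eps%:C.

(* MathComp's eigenvalue and eigenspace concern row vectors multiplied on the
   left, hence the transposes. *)
Definition is_eigenvalue (R : realType) (n : nat) (H : 'M[R[i]]_n) (E : R) :
    bool :=
  eigenvalue H^T E%:C.

Definition nondegenerate_eigenvalue (R : realType) (n : nat)
    (H : 'M[R[i]]_n) (E : R) : Prop :=
  is_eigenvalue H E /\ \rank (eigenspace H^T E%:C) = 1%N.

Definition normalized_eigenstate (R : realType) (n : nat) (H : 'M[R[i]]_n)
    (E : R) (v : 'cV[R[i]]_n) : Prop :=
  H *m v = E%:C *: v /\ l2norm v = 1.

(* Main.v *)
(* The double commutator of O with the Hamiltonian is of the order of the number
   N of sites while |O Phi0| >= mu o N, so the energy of Psi exceeds E0 by at most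
   O(1/N); by the gap, Psi is O(1/sqrt N)-close to the line of Phi1.

   For an exact eigenvector Phi and a local observable B summed over a region
   Omega, (B Phi, (H - E) B Phi) is half the expectation of [B, [H, B]], which is
   O(|Omega|); by the gap B Phi0 and B Psi lie in span(Phi0, Psi) up to vectors of
   norm O(sqrt |Omega|).  Inside this plane O acts, up to O(sqrt N), as |O Phi0|
   times the exchange of Phi0 and Psi: the diagonal terms vanish by the
   hypotheses on the first and third moments of O.  As [O, B] is bounded
   uniformly in N, B is asymptotically diagonal in the eigenbasis Xi, Xi' of that
   exchange.  Hence the variance of B in Xi is O(|Omega|) + O(1/N), which gives
   ergodicity once N goes to infinity with Omega fixed.

   Translation invariance holds already in finite volume, because Phi0 is
   nondegenerate and O is translation invariant.  The energy density converges
   because averaging translates of an open box Hamiltonian over a larger torus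
   bounds the larger ground state energy from below. *)
Require Import Defs.
From HB Require Import structures.
From mathcomp Require Import all_boot all_order all_algebra.
From mathcomp Require Import finmap complex.
From mathcomp Require Import all_classical all_reals all_analysis.
From mathcomp Require Import ring lra zify.

Set Implicit Arguments.
Unset Strict Implicit.
Unset Printing Implicit Defensive.

Import Order.TTheory GRing.Theory Num.Theory.
Import numFieldNormedType.Exports.

Local Open Scope classical_set_scope.
Local Open Scope ring_scope.
Local Open Scope complex_scope.
Local Open Scope sesquilinear_scope.

(** * Inner product, norm and positivity *)

(** The working plane is span(Phi0, Psi) and not the spectral subspace span(Phi0, Phi1), because Psi
    is explicit while Phi1 is known only through its energy. The price is that the plane is not
    invariant under H. One number [kappa] of order 1/N pays for it: it bounds the energy excess of
    Psi, the spacing E1 - E0 and, up to the factor EG, the weight of Psi off Phi1. Once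
    [kappa <= EG / 4], vectors orthogonal to the plane still lie at least EG / 2 above E0. Inside
    the plane the values M and - M are separated by 2 M, at least 2 mu o N, whereas the defect
    [zeta] of the exchange is only O(sqrt N); this makes the off-diagonal element of a local
    observable O(1/sqrt N). Coefficients of 1/N may depend on Omega in any way, since they vanish
    first. What survives is a constant times |Omega|, and it must not depend on the position of
    Omega. Norm bounds and positivity pass from a finite set of sites to every torus algebraically:
    [embed] respects products and adjoints, and a positive matrix is of the form B^* B. *)

Section HilbertSpace.
Variables (R : realType) (n : nat).
Implicit Types (u v w : 'cV[R[i]]_n) (A B H : 'M[R[i]]_n) (a z : R[i]).

Lemma innerE v w : inner v w = \sum_k (v k 0)^* * w k 0.
Proof. by rewrite /inner mxE; apply: eq_bigr => k _; rewrite !mxE. Qed.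

Lemma innerDr u v w : inner u (v + w) = inner u v + inner u w.
Proof. by rewrite /inner mulmxDr mxE. Qed.

Lemma innerDl u v w : inner (v + w) u = inner v u + inner w u.
Proof. by rewrite /inner linearD map_mxD mulmxDl mxE. Qed.

Lemma innerZr a v w : inner v (a *: w) = a * inner v w.
Proof. by rewrite /inner -scalemxAr mxE. Qed.

Lemma innerZl a v w : inner (a *: v) w = a^* * inner v w.
Proof. by rewrite /inner linearZ map_mxZ -scalemxAl mxE. Qed.

Lemma innerNr v w : inner v (- w) = - inner v w.
Proof. by rewrite -scaleN1r innerZr mulN1r. Qed.

Lemma innerNl v w : inner (- v) w = - inner v w.
Proof. by rewrite -scaleN1r innerZl rmorphN rmorph1 mulN1r. Qed.

Lemma inner0r v : inner v 0 = 0.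
Proof. by rewrite -[0](scale0r v) innerZr mul0r. Qed.

Lemma inner_sumr I (s : seq I) (P : pred I) (F : I -> 'cV[R[i]]_n) v :
  inner v (\sum_(k <- s | P k) F k) = \sum_(k <- s | P k) inner v (F k).
Proof. exact: (big_morph _ (innerDr v) (inner0r v)). Qed.

Lemma innerJ v w : inner w v = (inner v w)^*%R.
Proof.
rewrite !innerE rmorph_sum; apply: eq_bigr => k _.
by rewrite rmorphM /= conjCK mulrC.
Qed.

Lemma inner_adj A v w : inner v (A *m w) = inner (A^t* *m v) w.
Proof. by rewrite /inner trmx_mul map_mxM trmxCK mulmxA. Qed.

Lemma hermP A : A \is hermsymmx -> A^t* = A.
Proof. by move/is_hermitianmxP; rewrite expr0 scale1r => <-. Qed.

Lemma hermI A : A^t* = A -> A \is hermsymmx.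
Proof. by move=> h; apply/is_hermitianmxP; rewrite expr0 scale1r h. Qed.

Lemma inner_herm A v w : A \is hermsymmx -> inner (A *m v) w = inner v (A *m w).
Proof. by move=> hA; rewrite inner_adj hermP. Qed.

Lemma mulJc z : z^* * z = (Normc.normc z ^+ 2)%:C.
Proof.
case: z => x y; rewrite /= sqr_sqrtr ?addr_ge0 ?sqr_ge0 //.
by apply/eqP; rewrite eq_complex /=; apply/andP; split; apply/eqP; ring.
Qed.

Lemma inner_ge0 v : 0 <= inner v v.
Proof.
by rewrite innerE sumr_ge0 // => k _; rewrite mulJc ler0c sqr_ge0.
Qed.

Lemma innervv v : inner v v = (l2norm v ^+ 2)%:C.
Proof.
have := inner_ge0 v; rewrite lecE /= => /andP[/eqP im re].
by rewrite sqr_sqrtr //; case: (inner v v) im {re} => x y /= ->.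
Qed.

Lemma l2norm_ge0 v : 0 <= l2norm v. Proof. exact: sqrtr_ge0. Qed.

Lemma l2norm_eq0 v : l2norm v = 0 -> v = 0.
Proof.
move=> v0; have := innervv v; rewrite v0 expr0n /= innerE => h.
apply/colP => k; rewrite mxE.
have ge0 j : true -> 0 <= (v j 0)^* * v j 0.
  by rewrite mulJc ler0c sqr_ge0.
have /eqP := psumr_eq0P ge0 h (i := k) isT.
by rewrite mulf_eq0 conjc_eq0 orbb => /eqP.
Qed.

Lemma Re_real_complex (x : R) : complex.Re x%:C = x. Proof. by []. Qed.

Lemma ReM_real (x : R) z : complex.Re (x%:C * z) = x * complex.Re z.
Proof. by case: z => p r /=; rewrite mul0r subr0. Qed.

Lemma ReD (z z' : R[i]) : complex.Re (z + z') = complex.Re z + complex.Re z'.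
Proof. by case: z; case: z'. Qed.

Lemma ReN z : complex.Re (- z) = - complex.Re z.
Proof. by case: z. Qed.

Lemma Re_sum I (s : seq I) (P : pred I) (F : I -> R[i]) :
  complex.Re (\sum_(k <- s | P k) F k) = \sum_(k <- s | P k) complex.Re (F k).
Proof. exact: (big_morph _ ReD erefl). Qed.

Lemma ReJ z : complex.Re z^*%R = complex.Re z. Proof. by case: z. Qed.

Lemma conj_real (x : R) : (x%:C)^*%R = x%:C. Proof. exact: conjc_real. Qed.

Lemma normcJ z : Normc.normc z^*%R = Normc.normc z.
Proof. by case: z => x y /=; rewrite sqrrN. Qed.

Lemma Re_le_normc z : complex.Re z <= Normc.normc z.
Proof.
case: z => x y /=; apply: le_trans (ler_norm x) _; rewrite -sqrtr_sqr.
by rewrite ler_sqrt ?addr_ge0 ?sqr_ge0 // lerDl sqr_ge0.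
Qed.

Lemma normc_ge0 z : 0 <= Normc.normc z.
Proof. by case: z => x y; exact: sqrtr_ge0. Qed.

Lemma normc_real (x : R) : Normc.normc x%:C = `|x|.
Proof. by rewrite /= expr0n addr0 sqrtr_sqr. Qed.

Lemma normcE z : `|z| = (Normc.normc z)%:C.
Proof. by case: z. Qed.

Lemma normcD z z' :
  Normc.normc (z + z') <= Normc.normc z + Normc.normc z'.
Proof. by rewrite -lecR rmorphD /= -!normcE ler_normD. Qed.

Lemma l2normZ a v : l2norm (a *: v) = Normc.normc a * l2norm v.
Proof.
apply/eqP; rewrite -(@eqrXn2 _ 2) ?mulr_ge0 ?l2norm_ge0 ?normc_ge0 //.
apply/eqP/complexI; rewrite -innervv innerZl innerZr mulrA mulJc innervv.
by rewrite -rmorphM exprMn.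
Qed.

Lemma cauchy_schwarz v w : Normc.normc (inner v w) <= l2norm v * l2norm w.
Proof.
(* [dotmx] pairs row vectors and conjugates its second argument, hence the transposes and the
   swap. *)
have dotE u u' : dotmx u^T u'^T = inner u' u.
  rewrite dotmxE innerE mxE; apply: eq_bigr => k _.
  by rewrite !mxE mulrC.
have : `|dotmx w^T v^T| ^+ 2 <= dotmx w^T w^T * dotmx v^T v^T.
  by have [] := CauchySchwarz (@dotmx R[i] n) w^T v^T.
rewrite !dotE normcE !innervv -rmorphM -rmorphXn lecR.
rewrite mulrC -exprMn ler_sqr ?nnegrE ?mulr_ge0 ?l2norm_ge0 ?normc_ge0 //.
Qed.

Lemma l2normD v w : l2norm (v + w) <= l2norm v + l2norm w.
Proof.
rewrite -ler_sqr ?nnegrE ?addr_ge0 ?l2norm_ge0 //.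
rewrite -[leLHS]/(complex.Re (l2norm (v + w) ^+ 2)%:C) -innervv.
rewrite innerDl !innerDr [inner w v]innerJ !innervv !ReD ReJ /=.
have := le_trans (Re_le_normc _) (cauchy_schwarz v w).
nra.
Qed.

Lemma l2norm_sum (I : Type) (s : seq I) (P : pred I) (F : I -> 'cV[R[i]]_n) :
  l2norm (\sum_(k <- s | P k) F k) <= \sum_(k <- s | P k) l2norm (F k).
Proof.
elim/big_rec2: _ => [|k x v _ h].
  by rewrite -[0](scale0r 0) l2normZ normc_real normr0 mul0r.
by apply: le_trans (l2normD _ _) _; rewrite lerD2l.
Qed.

(** An upper bound on the operator norm as an inequality over all vectors, so that sums, products
    and embeddings are handled without a supremum. *)
Definition opbound (c : R) A := forall v, l2norm (A *m v) <= c * l2norm v.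

Lemma opbound_le c c' A : c <= c' -> opbound c A -> opbound c' A.
Proof.
by move=> cc' h v; apply: le_trans (h v) _; rewrite ler_wpM2r // l2norm_ge0.
Qed.

Lemma opboundD c c' A B :
  opbound c A -> opbound c' B -> opbound (c + c') (A + B).
Proof.
move=> hA hB v; rewrite mulmxDl mulrDl; apply: le_trans (l2normD _ _) _.
exact: lerD.
Qed.

Lemma opboundN c A : opbound c A -> opbound c (- A).
Proof.
move=> hA v; rewrite mulNmx -scaleN1r l2normZ -(rmorphN1 (real_complex R)).
by rewrite normc_real normrN1 mul1r.
Qed.

Lemma opboundM c c' A B : 0 <= c ->
  opbound c A -> opbound c' B -> opbound (c * c') (A *m B).
Proof.
move=> c0 hA hB v; rewrite -mulmxA; apply: le_trans (hA _) _.
by rewrite -mulrA ler_wpM2l.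
Qed.

Lemma opbound0 : opbound 0 0.
Proof.
by move=> v; rewrite mul0mx -(scale0r v) l2normZ normc_real normr0 !mul0r.
Qed.

Lemma opbound_sum (I : Type) (s : seq I) (P : pred I) (c : I -> R)
    (F : I -> 'M[R[i]]_n) :
  (forall k, P k -> opbound (c k) (F k)) ->
  opbound (\sum_(k <- s | P k) c k) (\sum_(k <- s | P k) F k).
Proof.
move=> h; elim/big_rec2: _ => [|k x v Pk hx]; first exact: opbound0.
exact: opboundD (h _ Pk) hx.
Qed.

Lemma opbound_inner c A v : opbound c A ->
  Normc.normc (inner v (A *m v)) <= c * l2norm v ^+ 2.
Proof.
move=> hA; apply: le_trans (cauchy_schwarz _ _) _.
by rewrite mulrC expr2 mulrA ler_wpM2r ?l2norm_ge0.
Qed.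

Lemma inner_delta k v : inner (delta_mx k 0) v = v k 0.
Proof.
rewrite innerE (bigD1 k) //= !mxE !eqxx rmorph_nat mul1r big1 ?addr0 //.
by move=> j jk; rewrite !mxE (negPf jk) rmorph_nat mul0r.
Qed.

Lemma l2norm_delta k : l2norm (delta_mx k 0 : 'cV[R[i]]_n) = 1.
Proof. by rewrite /l2norm inner_delta mxE !eqxx sqrtr1. Qed.

Lemma opbound_ex A : exists2 c, 0 <= c & opbound c A.
Proof.
pose e k : 'cV[R[i]]_n := delta_mx k 0.
have vE v : v = \sum_k v k 0 *: e k.
  apply/colP => j; rewrite summxE (bigD1 j) //= !mxE eqxx mulr1 big1 ?addr0 //.
  by move=> k kj; rewrite !mxE eq_sym (negPf kj) mulr0.
(* The sum of the column norms is crude, but any bound that depends on the matrix alone will do. *)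
exists (\sum_k l2norm (A *m e k)).
  by rewrite sumr_ge0 // => k _; exact: l2norm_ge0.
move=> v; rewrite {1}[v]vE mulmx_sumr; apply: le_trans (l2norm_sum _ _ _) _.
rewrite mulr_suml ler_sum // => k _; rewrite -scalemxAr l2normZ mulrC.
rewrite ler_wpM2l ?l2norm_ge0 // -inner_delta.
by apply: le_trans (cauchy_schwarz _ _) _; rewrite l2norm_delta mul1r.
Qed.

Lemma adjmxM A B : (A *m B)^t* = B^t* *m A^t*.
Proof. by rewrite trmx_mul map_mxM. Qed.

Lemma adjmxB A B : (A - B)^t* = A^t* - B^t*.
Proof. by rewrite linearB map_mxB. Qed.

Lemma adjmx_sum (I : Type) (s : seq I) (P : pred I) (F : I -> 'M[R[i]]_n) :
  (\sum_(k <- s | P k) F k)^t* = \sum_(k <- s | P k) (F k)^t*.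
Proof.
apply: (big_morph (fun M : 'M[R[i]]_n => M^t*)) => [M M'|].
  by rewrite linearD map_mxD.
by rewrite linear0 map_mx0.
Qed.

Lemma adjmx_scalar_real (x : R) : (x%:C%:M : 'M[R[i]]_n)^t* = x%:C%:M.
Proof.
by rewrite tr_scalar_mx map_scalar_mx; congr (_%:M); exact: conjc_real.
Qed.

Definition psd A := forall v, 0 <= complex.Re (inner v (A *m v)).

(** Parallelogram law: the right side minus the left side is the form at [v - w]. *)
Lemma psd_seminorm_add A v w : psd A ->
  complex.Re (inner (v + w) (A *m (v + w)))
    <= 2 * complex.Re (inner v (A *m v)) + 2 * complex.Re (inner w (A *m w)).
Proof.
move=> /(_ (v - w)); rewrite !mulmxDr mulmxN.
rewrite !(innerDl, innerDr, innerNr, innerNl).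
rewrite !(ReD, ReN); move: (complex.Re _) (complex.Re _) (complex.Re _).
by move=> x y z; move: (complex.Re _) => t *; lra.
Qed.

End HilbertSpace.

(** * Spectral decomposition, energy bounds and square roots *)

Section Spectral.
Variables (R : realType) (n : nat).
Implicit Types (v w : 'cV[R[i]]_n) (A H : 'M[R[i]]_n).

Lemma hermitian_spectral H : H \is hermsymmx ->
  exists (U : 'M[R[i]]_n) (D : 'I_n -> R),
    [/\ U *m U^t* = 1%:M, U^t* *m U = 1%:M
      & H = U^t* *m diag_mx (\row_k (D k)%:C) *m U].
Proof.
move=> hH; pose U := spectralmx H.
have Uu : U \is unitarymx := spectral_unitarymx H.
exists U, (fun k => complex.Re (spectral_diag H 0 k)).
have UU : U *m U^t* = 1%:M by exact/unitarymxP.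
split=> //; first exact: mulmx1C.
have -> : \row_k (complex.Re (spectral_diag H 0 k))%:C = spectral_diag H.
  apply/rowP => k; rewrite mxE RRe_real //.
  exact: (mxOverP (hermitian_spectral_diag_real hH)).
rewrite -(invmx_unitary Uu).
exact: (orthomx_spectralP (hermitian_normalmx hH)).
Qed.

Lemma inner_unitary (U : 'M[R[i]]_n) v w :
  U^t* *m U = 1%:M -> inner (U *m v) (U *m w) = inner v w.
Proof. by move=> UU; rewrite inner_adj mulmxA UU mul1mx. Qed.

Lemma inner_diag (D : 'I_n -> R) v :
  inner v (diag_mx (\row_k (D k)%:C) *m v)
    = (\sum_k D k * Normc.normc (v k 0) ^+ 2)%:C.
Proof.
rewrite innerE rmorph_sum; apply: eq_bigr => k _.
rewrite mul_diag_mx !mxE mulrCA rmorphM; congr (_ * _).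
exact: mulJc.
Qed.

Lemma l2norm_sumsq v : l2norm v ^+ 2 = \sum_k Normc.normc (v k 0) ^+ 2.
Proof.
apply: complexI; rewrite -innervv innerE rmorph_sum.
by apply: eq_bigr => k _; exact: mulJc.
Qed.

Lemma inner_adjl A v w : inner (A *m v) w = inner v (A^t* *m w).
Proof. by rewrite inner_adj trmxCK. Qed.

Lemma diag_mx_delta (D : 'rV[R[i]]_n) k :
  diag_mx D *m (delta_mx k 0 : 'cV[R[i]]_n) = D 0 k *: delta_mx k 0.
Proof.
apply/colP => j; rewrite mul_diag_mx !mxE.
by case: eqVneq => [->|_]; rewrite ?mulr0.
Qed.

(** In an orthonormal eigenbasis the expectation is a weighted sum of eigenvalues, and the
    hypothesis removes all weight below [e]. Since it speaks of all eigenvectors [f], the bounds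
    with zero, one or two known levels projected out are instances. *)
Lemma spectral_lower_bound H v (e : R) : H \is hermsymmx ->
  (forall x f, H *m f = x%:C *: f -> l2norm f = 1 -> x < e -> inner f v = 0) ->
  e * l2norm v ^+ 2 <= complex.Re (inner v (H *m v)).
Proof.
move=> hH hv; have [U [D [UU UU' HE]]] := hermitian_spectral hH.
have eigen k : H *m (U^t* *m (delta_mx k 0 : 'cV_n))
    = (D k)%:C *: (U^t* *m delta_mx k 0).
  rewrite {1}HE -!mulmxA (mulmxA U) UU mul1mx diag_mx_delta mxE.
  by rewrite -scalemxAr.
have -> : l2norm v = l2norm (U *m v) by rewrite /l2norm inner_unitary.
rewrite HE -!mulmxA -inner_adjl inner_diag l2norm_sumsq mulr_sumr /=.
apply: ler_sum => k _; have [le_eD|lt_De] := leP e (D k).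
  by rewrite ler_wpM2r ?sqr_ge0.
rewrite -inner_delta inner_adj (hv (D k)) ?eigen //.
  by rewrite Normc.normc0 expr0n !mulr0.
by rewrite -(l2norm_delta R k) /l2norm inner_unitary ?trmxCK.
Qed.

(** This form of positivity survives [embed], which respects products and adjoints. *)
Lemma psd_factor A : A \is hermsymmx -> psd A ->
  exists B : 'M[R[i]]_n, A = B^t* *m B.
Proof.
move=> hA pA; have [U [D [UU UU' AE]]] := hermitian_spectral hA.
have D0 k : 0 <= D k.
  have := pA (U^t* *m delta_mx k 0).
  rewrite AE -!mulmxA (mulmxA U) UU mul1mx -inner_adjl mulmxA UU mul1mx.
  rewrite diag_mx_delta innerZr inner_delta !mxE !eqxx mulr1.
  by rewrite Re_real_complex.
exists (diag_mx (\row_k (Num.sqrt (D k))%:C) *m U).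
rewrite trmx_mul map_mxM tr_diag_mx map_diag_mx.
rewrite mulmxA -[X in X *m U]mulmxA mulmx_diag.
have -> : A = U^t* *m diag_mx (\row_k (D k)%:C) *m U := AE.
apply: (congr1 (fun X => U^t* *m diag_mx X *m U)).
apply/rowP => k; rewrite !mxE.
transitivity ((Num.sqrt (D k))%:C^* * (Num.sqrt (D k))%:C); last by [].
by rewrite mulJc normc_real real_normK ?num_real ?sqr_sqrtr.
Qed.

Lemma nondegenerate_colinear H (E : R) v w :
  nondegenerate_eigenvalue H E -> H *m v = E%:C *: v -> H *m w = E%:C *: w ->
  w != 0 -> exists a, v = a *: w.
Proof.
move=> [_ rk1] hv hw w0.
have sub (u : 'cV[R[i]]_n) :
    H *m u = E%:C *: u -> (u^T <= eigenspace H^T E%:C)%MS.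
  by move=> hu; apply/eigenspaceP; rewrite -trmx_mul hu linearZ.
have : (eigenspace H^T E%:C <= w^T)%MS.
  rewrite -(geq_leqif (mxrank_leqif_sup (sub _ hw))) rk1 lt0n mxrank_eq0.
  by rewrite trmx_eq0.
move=> /(submx_trans (sub _ hv))/sub_rVP[a ha]; exists a.
by apply: trmx_inj; rewrite ha linearZ.
Qed.

End Spectral.

(** * Operators extended by the identity *)

Section Embedding.
Variables (R : realType) (q : nat).

Definition off (V W : finType) (f : V -> W) (s t : config q W) :=
  [forall w, (w \notin codom f) ==> (s w == t w)].

Lemma offP (V W : finType) (f : V -> W) (s t : config q W) :
  reflect (forall w, w \notin codom f -> s w = t w) (off f s t).
Proof.
apply: (iffP forallP) => h w; first by move=> wf; apply/eqP/(implyP (h w)).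
by apply/implyP => wf; apply/eqP/h.
Qed.

Definition pullback (V W : finType) (f : V -> W) (s : config q W) :
    config q V := [ffun a => s (f a)].

(** Matrix elements indexed by configurations instead of their numbers; in this indexing [off] and
    [pullback] are the two ingredients of [embed]. *)
Definition matel (V : finType) (A : op R q V) (s t : config q V) : R[i] :=
  A (enum_rank s) (enum_rank t).

Lemma matelP (V : finType) (A B : op R q V) :
  (forall s t, matel A s t = matel B s t) -> A = B.
Proof.
move=> h; apply/matrixP => i j.
by have := h (enum_val i) (enum_val j); rewrite /matel !enum_valK.
Qed.

Lemma matel_embed (V W : finType) (f : V -> W) (A : op R q V) s t :
  matel (embed f A) s t =
    if off f s t then matel A (pullback f s) (pullback f t) else 0.
Proof. by rewrite /matel mxE !enum_rankK. Qed.

Lemma matel_mul (V : finType) (A B : op R q V) s t :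
  matel (A *m B) s t = \sum_u matel A s u * matel B u t.
Proof.
rewrite /matel mxE (reindex (@enum_rank {: config q V})) //=.
by exists enum_val => u _; rewrite ?enum_rankK ?enum_valK.
Qed.

Lemma matel1 (V : finType) s t : matel (1%:M : op R q V) s t = (s == t)%:R.
Proof. by rewrite /matel mxE (inj_eq enum_rank_inj). Qed.

(** For injective [f] and varying [u], these are exactly the configurations that agree with [s] off
    the image of [f]. They parametrize the intermediate configurations in a product of embedded
    operators. *)
Definition glue (V W : finType) (f : V -> W) (u : config q V) (s : config q W) :
    config q W :=
  [ffun w => if [pick a | f a == w] is Some a then u a else s w].

Lemma glue_in (V W : finType) (f : V -> W) u s a :
  injective f -> glue f u s (f a) = u a.
Proof.
move=> inj; rewrite ffunE; case: pickP => [b /eqP/inj -> //|/(_ a)].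
by rewrite eqxx.
Qed.

Lemma glue_off (V W : finType) (f : V -> W) u s w :
  w \notin codom f -> glue f u s w = s w.
Proof.
move=> wf; rewrite ffunE; case: pickP => // a /eqP fa.
by rewrite -fa codom_f in wf.
Qed.

Lemma pullback_glue (V W : finType) (f : V -> W) u s :
  injective f -> pullback f (glue f u s) = u.
Proof. by move=> inj; apply/ffunP => a; rewrite ffunE glue_in. Qed.

Lemma glue_pullback (V W : finType) (f : V -> W) s t :
  injective f -> off f s t -> glue f (pullback f t) s = t.
Proof.
move=> inj /offP st; apply/ffunP => w.
have [/codomP[a ->]|wf] := boolP (w \in codom f).
  by rewrite glue_in // ffunE.
by rewrite glue_off // st.
Qed.

Lemma off_sym (V W : finType) (f : V -> W) s t : off f s t = off f t s.
Proof. by apply/offP/offP => h w wf; rewrite h. Qed.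

Lemma off_trans (V W : finType) (f : V -> W) s t u :
  off f s t -> off f t u = off f s u.
Proof.
by move=> /offP st; apply/offP/offP => h w wf; rewrite ?st ?h // -st ?h.
Qed.

Lemma off_glue (V W : finType) (f : V -> W) u s : off f s (glue f u s).
Proof. by apply/offP => w wf; rewrite glue_off. Qed.

Lemma off_glue_l (V W : finType) (f : V -> W) u s t :
  off f (glue f u s) t = off f s t.
Proof. exact/off_trans/off_glue. Qed.

Lemma embedM (V W : finType) (f : V -> W) (A B : op R q V) :
  injective f -> embed f (A *m B) = embed f A *m embed f B.
Proof.
move=> inj; apply: matelP => s t; rewrite matel_mul matel_embed.
rewrite (bigID (off f s)) /= [X in _ = _ + X]big1 ?addr0; last first.
  by move=> u /negPf su; rewrite matel_embed su mul0r.
rewrite (reindex_onto (fun u => glue f u s) (pullback f)) /=; last first.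
  by move=> u su; rewrite glue_pullback.
under eq_bigl => u do rewrite off_glue pullback_glue // eqxx.
case: ifP => st.
  rewrite matel_mul; apply: eq_bigr => u _; rewrite !matel_embed off_glue.
  by rewrite pullback_glue // off_glue_l st.
by rewrite big1 // => u _; rewrite !matel_embed off_glue off_glue_l st mulr0.
Qed.

Lemma embed1 (V W : finType) (f : V -> W) :
  injective f -> embed f (1%:M : op R q V) = 1%:M.
Proof.
move=> inj; apply: matelP => s t; rewrite matel_embed !matel1.
case: ifP => st.
  suff -> : (pullback f s == pullback f t) = (s == t) by [].
  apply/eqP/eqP => [eq|->//].
  by rewrite -(glue_pullback inj st) -eq glue_pullback //; apply/offP.
by case: eqVneq => // eq; move/offP: st; rewrite eq; case.
Qed.

Lemma embed_is_linear (V W : finType) (f : V -> W) :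
  linear (@embed R q V W f).
Proof.
move=> a A B; apply/matrixP => i j; rewrite !mxE /=.
by case: ifP => _; rewrite ?mulr0 ?addr0 // !mxE.
Qed.

HB.instance Definition _ (V W : finType) (f : V -> W) :=
  GRing.isLinear.Build _ _ _ _ (@embed R q V W f) (embed_is_linear f).

Lemma embed_adj (V W : finType) (f : V -> W) (A : op R q V) :
  embed f (A^t*) = (embed f A)^t*.
Proof.
have matel_adj U (B : op R q U) s t : matel (B^t*) s t = (matel B t s)^*.
  by rewrite /matel !mxE.
apply: matelP => s t; rewrite matel_embed !matel_adj matel_embed off_sym.
by case: ifP => _; rewrite ?conjc0.
Qed.

Lemma embed_scalar (V W : finType) (f : V -> W) (a : R[i]) :
  injective f -> embed f (a%:M : op R q V) = a%:M.
Proof. by move=> inj; rewrite -scalemx1 linearZ /= embed1 // scalemx1. Qed.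

Lemma embed_comp (U V W : finType) (f : U -> V) (g : V -> W) (A : op R q U) :
  injective g -> embed g (embed f A) = embed (g \o f) A.
Proof.
move=> inj; apply: matelP => s t; rewrite !matel_embed.
have pb x : pullback f (pullback g x) = pullback (g \o f) x.
  by apply/ffunP => a; rewrite !ffunE.
rewrite !pb; suff -> : off (g \o f) s t =
    off g s t && off f (pullback g s) (pullback g t) by case: (off g s t).
apply/offP/andP => [h|[/offP hg /offP hf] w wgf].
  split; apply/offP => w wf.
    by apply: h; apply: contra wf => /codomP[a ->]; exact: codom_f.
  rewrite !ffunE; apply: h; apply: contra wf => /codomP[a /inj ->].
  exact: codom_f.
have [/codomP[v wE]|] := boolP (w \in codom g); last exact: hg.
have := hf v; rewrite !ffunE -wE; apply; apply: contra wgf => /codomP[a vE].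
by rewrite wE vE; exact: (codom_f (g \o f)).
Qed.

(** A single intermediate configuration contributes: it equals [t] on the image of [f] and [s]
    elsewhere. The resulting formula is symmetric in the two operators, which yields
    [embed_commute]. *)
Lemma matel_embedM_disjoint (V V' W : finType) (f : V -> W) (g : V' -> W)
    (A : op R q V) (B : op R q V') s t :
  injective f -> (forall a b, f a != g b) ->
  matel (embed f A *m embed g B) s t =
    if [forall w, (w \notin codom f) && (w \notin codom g) ==> (s w == t w)]
    then matel A (pullback f s) (pullback f t)
         * matel B (pullback g s) (pullback g t) else 0.
Proof.
move=> inj fg; rewrite matel_mul.
pose u := glue f (pullback f t) s.
have gf b : g b \notin codom f.
  by apply/negP => /codomP[a /eqP]; rewrite eq_sym (negPf (fg a b)).
rewrite (bigD1 u) //= [X in _ + X]big1 ?addr0 => [|x xu]; last first.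
  rewrite !matel_embed; case: ifP => [/offP sx|_]; last by rewrite mul0r.
  case: ifP => [/offP xt|_]; last by rewrite mulr0.
  case/eqP: xu; apply/ffunP => w.
  have [/codomP[a ->]|wf] := boolP (w \in codom f).
    rewrite glue_in // ffunE xt //; apply/negP => /codomP[b /eqP].
    by rewrite (negPf (fg a b)).
  by rewrite glue_off // sx.
rewrite !matel_embed off_glue pullback_glue //.
have -> : pullback g u = pullback g s.
  by apply/ffunP => b; rewrite [LHS]ffunE [RHS]ffunE glue_off.
have -> : off g u t =
    [forall w, (w \notin codom f) && (w \notin codom g) ==> (s w == t w)].
  apply/offP/forallP => [h w|h w wg].
    by apply/implyP => /andP[wf wg]; rewrite -(h w wg) glue_off.
  have [/codomP[a ->]|wf] := boolP (w \in codom f).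
    by rewrite glue_in // ffunE.
  by rewrite glue_off //; apply/eqP/(implyP (h w)); rewrite wf.
by case: ifP => _; rewrite ?mulr0.
Qed.

Lemma embed_commute (V V' W : finType) (f : V -> W) (g : V' -> W)
    (A : op R q V) (B : op R q V') :
  injective f -> injective g -> (forall a b, f a != g b) ->
  embed f A *m embed g B = embed g B *m embed f A.
Proof.
move=> injf injg fg; apply: matelP => s t.
rewrite !matel_embedM_disjoint // => [|a b]; last by rewrite eq_sym.
by rewrite mulrC; under eq_forallb do rewrite andbC.
Qed.

Lemma embed_psd (V W : finType) (f : V -> W) (A : op R q V) :
  injective f -> A \is hermsymmx -> psd A -> psd (embed f A).
Proof.
move=> inj hA pA v; have [B ->] := psd_factor hA pA.
rewrite embedM // embed_adj -mulmxA -inner_adjl innervv /=.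
exact: sqr_ge0.
Qed.

Lemma embed_herm (V W : finType) (f : V -> W) (A : op R q V) :
  A \is hermsymmx -> embed f A \is hermsymmx.
Proof. by move=> hA; apply: hermI; rewrite -embed_adj hermP. Qed.

(** The bound [c] on [A] says that [c ^+ 2 - A^* A] is positive, and [embed_psd] carries this
    over. *)
Lemma embed_opbound (V W : finType) (f : V -> W) (A : op R q V) (c : R) :
  injective f -> 0 <= c -> opbound c A -> opbound c (embed f A).
Proof.
move=> inj c0 hA v.
have psdP U (X : op R q U) (w : vec R q U) :
    complex.Re (inner w (((c ^+ 2)%:C%:M - X^t* *m X) *m w))
      = (c * l2norm w) ^+ 2 - l2norm (X *m w) ^+ 2.
  rewrite mulmxBl innerDr innerNr -mulmxA -inner_adjl mul_scalar_mx innerZr.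
  by rewrite !innervv -rmorphM ReD ReN /= exprMn.
have := @embed_psd _ _ f ((c ^+ 2)%:C%:M - A^t* *m A) inj _ _ v.
rewrite linearB /= embed_scalar // embedM // embed_adj psdP subr_ge0.
rewrite ler_sqr ?nnegrE ?mulr_ge0 ?l2norm_ge0 //; apply.
  by apply: hermI; rewrite adjmxB adjmx_scalar_real adjmxM trmxCK.
by move=> w; rewrite psdP subr_ge0 ler_sqr ?nnegrE ?mulr_ge0 ?l2norm_ge0.
Qed.

End Embedding.

(** * Translations and locality on the torus *)

Section Torus.
Variable d : nat.
Implicit Types (S T : {fset zd d}) (l : nat).

Lemma to_torusE l (x : zd d) i :
  ((to_torus l x i : nat)%:Z = (x i %% l.+1%:Z)%Z)%R.
Proof.
rewrite ffunE /= modn_small; last first.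
  by rewrite -ltz_nat gez0_abs ?modz_ge0 // ltz_pmod.
by rewrite gez0_abs // modz_ge0.
Qed.

Lemma to_torusD l (x y : zd d) :
  to_torus l (x + y) = to_torus l x + to_torus l y.
Proof.
apply/ffunP => i; apply: ord_inj; apply/eqP; rewrite -eqz_nat to_torusE.
rewrite [(to_torus l x + to_torus l y) i]ffunE /= -modz_nat PoszD !to_torusE.
by rewrite ffunE modzDml modzDmr.
Qed.

Definition fits l S := {in S &, injective (to_torus l)}.

Lemma fset_bound S : exists k : nat, forall x i, x \in S -> (`|x i| <= k)%N.
Proof.
exists (\max_(x : S) \max_i `|fsval x i|)%N => x i xS.
have := leq_bigmax (F := fun x : S => \max_i `|fsval x i|)%N [` xS]%fset.
exact: leq_trans (leq_bigmax (F := fun i => `|x i|%N) i).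
Qed.

Lemma eventually_fits S : exists l0, forall l, (l0 <= l)%N -> fits l S.
Proof.
(* Coordinates of two sites differ by at most [2k], and a nonzero multiple of the side length
   [l.+1 > 2k] cannot be that small. *)
have [k hk] := fset_bound S; exists (k + k)%N => l kl x y xS yS xy.
apply/ffunP => i; have := to_torusE l x i; rewrite xy to_torusE => /eqP.
rewrite eq_sym eqz_mod_dvd => dv; apply/eqP; rewrite -subr_eq0 -absz_eq0.
apply/negPn/negP; rewrite -lt0n => gt0.
move: dv; rewrite /dvdz /= => /(dvdn_leq gt0).
move: (hk x i xS) (hk y i yS) kl; move: (x i : int) (y i : int) => u v; lia.
Qed.

Lemma fits_sub l S T : (S `<=` T)%fset -> fits l T -> fits l S.
Proof. by move=> /fsubsetP ST fT x y xS yS; apply: fT; apply: ST. Qed.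

Definition site l (S : {fset zd d}) (x : torus d l) (y : S) : torus d l :=
  x + to_torus l (fsval y).

Lemma site_inj l S (x : torus d l) : fits l S -> injective (@site l S x).
Proof.
by move=> fS s t /addrI /fS h; apply: val_inj; apply: h; exact: fsvalP.
Qed.

(** Overlap of the supports of two translates; translates that do not touch commute. *)
Definition touch l S T (x z : torus d l) :=
  [exists s : S, exists t : T, site x s == site z t].

Lemma touch_sym l S T (x z : torus d l) : touch S T x z = touch T S z x.
Proof.
by apply/existsP/existsP => -[s /existsP[t /eqP e]]; exists t; apply/existsP;
  exists s; rewrite e.
Qed.

(** A coinciding pair of sites [s], [t] determines [x] as [z + t - s], so the count does not depend
    on [l]. *)
Lemma card_touch l S T (z : torus d l) :
  (#|[set x | touch S T x z]%SET| <= #|{: S}| * #|{: T}|)%N.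
Proof.
rewrite -card_prod.
pose f (p : S * T) : torus d l := site z p.2 - to_torus l (fsval p.1).
apply: leq_trans (leq_imset_card f predT).
apply/subset_leq_card/fintype.subsetP => x.
rewrite inE => /existsP[s /existsP[t /eqP e]].
by apply/imsetP; exists (s, t) => //; rewrite /f /= -e addrK.
Qed.

End Torus.

Section Translates.
Variables (R : realType) (d q l : nat).
Implicit Types (S T : {fset zd d}) (x y z : torus d l).

Lemma tau_on_torus S (A : op R q S) x :
  tau x (on_torus l A) = embed (@site d l S x) A.
Proof. by rewrite /tau /on_torus embed_comp //; exact: addrI. Qed.

Lemma on_torus_site S (A : op R q S) : on_torus l A = embed (@site d l S 0) A.
Proof.
by rewrite /on_torus; congr embed; apply/funext => y; rewrite /site add0r.
Qed.

Lemma tau_tau x y (A : op R q (torus d l)) : tau x (tau y A) = tau (x + y) A.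
Proof.
rewrite /tau embed_comp; last exact: addrI.
by congr embed; apply/funext => z /=; rewrite addrA.
Qed.

Lemma tau_sumE S (A : op R q S) :
  tau_sum l A = \sum_x embed (@site d l S x) A.
Proof. by apply: eq_bigr => x _; rewrite tau_on_torus. Qed.

Lemma tau_tau_sum x S (A : op R q S) : tau x (tau_sum l A) = tau_sum l A.
Proof.
rewrite /tau_sum {1}/tau linear_sum [RHS](reindex_inj (addrI x)) /=.
by apply: eq_bigr => y _; rewrite -/(tau x _) tau_tau.
Qed.

Lemma tau_sum_herm S (A : op R q S) :
  A \is hermsymmx -> tau_sum l A \is hermsymmx.
Proof.
move=> hA; apply: hermI; rewrite tau_sumE adjmx_sum.
by apply: eq_bigr => x _; rewrite -embed_adj hermP.
Qed.

Lemma touchN S T x z : ~~ touch S T x z -> forall s t,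
  @site d l S x s != @site d l T z t.
Proof.
rewrite negb_exists => /forallP h s t; move: (h s).
by rewrite negb_exists => /forallP.
Qed.

Lemma sum_touch S T z :
  \sum_x (touch S T x z)%:R <= (#|{: S}| * #|{: T}|)%:R :> R.
Proof.
rewrite -natr_sum ler_nat; apply: leq_trans (card_touch S T z).
rewrite -sum1dep_card [leqRHS]big_mkcond /=; apply: leq_sum => x _.
by case: touch.
Qed.

End Translates.

Section Translation.
Variables (R : realType) (d q l : nat) (x : torus d l).
Implicit Types (v w : vec R q (torus d l)) (A : op R q (torus d l)).

Let sigma (i : 'I_#|{: config q (torus d l)}|) : 'I_#|{: config q (torus d l)}| :=
  enum_rank (pullback (fun y => x + y) (enum_val i)).

Lemma sigma_inj : injective sigma.
Proof.
move=> i j /enum_rank_inj /ffunP h; apply: enum_val_inj; apply/ffunP => y.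
by have := h (y - x); rewrite !ffunE addrC subrK.
Qed.

(** The unitary on vectors that implements [tau x]: see [tau_translate] and [inner_translate]. *)
Definition translate v : vec R q (torus d l) := \col_i v (sigma i) 0.

Lemma tau_sigma A i j : tau x A i j = A (sigma i) (sigma j).
Proof.
rewrite /tau mxE /= ifT //; apply/forallP => w; apply/implyP => /negP[].
by apply/codomP; exists (w - x); rewrite addrC subrK.
Qed.

Lemma tau_translate A v : tau x A *m translate v = translate (A *m v).
Proof.
apply/colP => i; rewrite !mxE [RHS](reindex_inj sigma_inj).
by apply: eq_bigr => j _; rewrite tau_sigma mxE.
Qed.

Lemma inner_translate v w : inner (translate v) (translate w) = inner v w.
Proof.
rewrite !innerE [RHS](reindex_inj sigma_inj).
by apply: eq_bigr => j _; rewrite !mxE.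
Qed.

Lemma translate_is_linear : linear translate.
Proof. by move=> a v w; apply/colP => i; rewrite !mxE. Qed.

HB.instance Definition _ :=
  GRing.isLinear.Build _ _ _ _ translate translate_is_linear.

End Translation.

(** * Commutators of sums of translated local operators *)

Section Commutators.
Variables (R : realType) (n : nat).
Implicit Types A B : 'M[R[i]]_n.

Definition commutator A B := A *m B - B *m A.

Lemma commutator_suml (I : Type) (s : seq I) (P : pred I)
    (F : I -> 'M[R[i]]_n) B :
  commutator (\sum_(k <- s | P k) F k) B
    = \sum_(k <- s | P k) commutator (F k) B.
Proof. by rewrite /commutator mulmx_suml mulmx_sumr -sumrB. Qed.

Lemma commutator_sumr (I : Type) (s : seq I) (P : pred I)
    (F : I -> 'M[R[i]]_n) B :
  commutator B (\sum_(k <- s | P k) F k)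
    = \sum_(k <- s | P k) commutator B (F k).
Proof. by rewrite /commutator mulmx_suml mulmx_sumr -sumrB. Qed.

Lemma opbound_commutator (a b : R) A B : 0 <= a -> 0 <= b ->
  opbound a A -> opbound b B -> opbound (2 * (a * b)) (commutator A B).
Proof.
move=> a0 b0 hA hB; rewrite mulr_natl mulr2n {2}[a * b]mulrC.
by apply: opboundD; [|apply: opboundN]; exact: opboundM.
Qed.

Lemma double_commutator_commute A B (D : 'M[R[i]]_n) :
  A *m B = B *m A -> A *m D = D *m A -> commutator A (commutator B D) = 0.
Proof.
move=> AB AD; rewrite /commutator mulmxBr mulmxBl !mulmxA AB AD.
by rewrite -[B *m A *m D]mulmxA AD -[D *m A *m B]mulmxA AB !mulmxA subrr.
Qed.

End Commutators.

Section Locality.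
Variables (R : realType) (d q l : nat) (S T : {fset zd d}).
Variables (A : op R q T) (h : op R q S) (a c : R).
Hypotheses (fS : fits l S) (fT : fits l T).
Hypotheses (a0 : 0 <= a) (c0 : 0 <= c).
Hypotheses (hA : opbound a A) (hh : opbound c h).

Let Ax x : op R q (torus d l) := embed (@site d l T x) A.
Let hx x : op R q (torus d l) := embed (@site d l S x) h.

Let bA x : opbound a (Ax x).
Proof. by apply: embed_opbound => //; exact: site_inj. Qed.

Let bh x : opbound c (hx x).
Proof. by apply: embed_opbound => //; exact: site_inj. Qed.

Let Ah x y : ~~ touch T S x y -> Ax x *m hx y = hx y *m Ax x.
Proof.
by move=> xy; apply: embed_commute; [exact: site_inj..|exact: touchN].
Qed.

Let AA x y : ~~ touch T T x y -> Ax x *m Ax y = Ax y *m Ax x.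
Proof.
by move=> xy; apply: embed_commute; [exact: site_inj..|exact: touchN].
Qed.

(* A term [A_x, [h_y, A_z]] vanishes unless h_y touches A_z and A_x touches one
   of the two, so for each z only boundedly many pairs (x, y) contribute. *)
Lemma opbound_double_commutator (X : {set torus d l}) :
  let B := \sum_(x in X) Ax x in
  opbound (4 * a ^+ 2 * c * ((#|{: S}| * #|{: T}|) *
             (#|{: T}| * #|{: T}| + #|{: S}| * #|{: T}|))%:R * #|X|%:R)
    (commutator B (commutator (tau_sum l h) B)).
Proof.
move=> B; rewrite tau_sumE {2}/B commutator_sumr commutator_sumr.
(* Two nested commutators of norms [a], [c], [a] give 2 * 2 * a * c * a; the sum of two indicators
   dominates the indicator that [A_x] touches one of the two others. *)
pose m (y z x : torus d l) : R := 4 * a ^+ 2 * c *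
   ((touch S T y z)%:R * ((touch T T x z)%:R + (touch T S x y)%:R)).
suff : opbound (\sum_(z in X) \sum_y \sum_(x in X) m y z x)
    (\sum_(z in X) commutator B (commutator (\sum_x hx x) (Ax z))).
  apply: opbound_le; rewrite -sumr_const mulr_sumr ler_sum // => z _.
  rewrite mulr1 natrM.
  have inner_le (y : torus d l) : \sum_(x in X)
      ((touch T T x z)%:R + (touch T S x y)%:R)
      <= (#|{: T}| * #|{: T}| + #|{: S}| * #|{: T}|)%:R :> R.
    apply: (@le_trans _ _ (\sum_x ((touch T T x z)%:R + (touch T S x y)%:R))).
      rewrite [leRHS](bigID (mem X)) /= lerDl sumr_ge0 //.
    by rewrite big_split natrD /= lerD ?sum_touch // mulnC sum_touch.
  under eq_bigr do rewrite /m -mulr_sumr -mulr_sumr.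
  rewrite -mulr_sumr ler_wpM2l ?mulr_ge0 ?sqr_ge0 //.
  apply: (@le_trans _ _ (\sum_(y : torus d l) (touch S T y z)%:R
      * (#|{: T}| * #|{: T}| + #|{: S}| * #|{: T}|)%:R)).
    by apply: ler_sum => y _; rewrite ler_wpM2l.
  by rewrite -mulr_suml ler_wpM2r ?sum_touch.
apply: opbound_sum => z zX; rewrite commutator_suml commutator_sumr.
apply: opbound_sum => y _; rewrite commutator_suml.
apply: opbound_sum => x _; rewrite /m.
have [yz|yz] := boolP (touch S T y z); last first.
  rewrite mul0r mulr0 /commutator -Ah; last by rewrite touch_sym.
  by rewrite subrr mulmx0 mul0mx subr0; exact: opbound0.
have ca0 : 0 <= 2 * (c * a) by rewrite !mulr_ge0.
have bound : opbound (4 * a ^+ 2 * c)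
    (commutator (Ax x) (commutator (hx y) (Ax z))).
  rewrite (_ : 4 * _ * c = 2 * (a * (2 * (c * a)))); last by ring.
  have hA' := opbound_commutator c0 a0 (bh y) (bA z).
  exact: (opbound_commutator a0 ca0 (bA x) hA').
have ac0 : 0 <= 4 * a ^+ 2 * c by rewrite !mulr_ge0 ?sqr_ge0.
rewrite mul1r.
have [xz|xz] := boolP (touch T T x z).
  by apply: opbound_le bound; rewrite mulrDr mulr1 lerDl mulr_ge0.
have [xy|xy] := boolP (touch T S x y).
  by apply: opbound_le bound; rewrite add0r mulr1.
rewrite (double_commutator_commute (Ah xy) (AA xz)) addr0 mulr0.
exact: opbound0.
Qed.

Lemma opbound_tau_sum : opbound (#|{: torus d l}|%:R * a) (tau_sum l A).
Proof.
rewrite tau_sumE mulr_natl -sumr_const; apply: opbound_sum => x _; exact: bA.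
Qed.

(** Only the translates of [A] that meet the support of [h] at [x] contribute, so the bound is free
    of the volume. It is applied with the order operator for [A] and an arbitrary local observable
    for [h]. *)
Lemma opbound_commutator_tau_sum x :
  opbound (2 * (a * c) * (#|{: T}| * #|{: S}|)%:R)
    (commutator (tau_sum l A) (hx x)).
Proof.
rewrite tau_sumE commutator_suml.
apply: (@opbound_le _ _ (\sum_y 2 * (a * c) * (touch T S y x)%:R)).
  by rewrite -mulr_sumr ler_wpM2l ?mulr_ge0 // sum_touch.
apply: opbound_sum => y _; have [yx|yx] := boolP (touch T S y x).
  by rewrite mulr1; exact: (opbound_commutator a0 c0 (bA y) (bh x)).
by rewrite mulr0 /commutator Ah // subrr; exact: opbound0.
Qed.

End Locality.

(** * States below the gap *)

Section EnergyArithmetic.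
Variable F : realFieldType.

Lemma level_spacing_arith (E0 E1 k x : F) :
  E1 <= x -> x <= E0 + k -> E1 - E0 <= k.
Proof. by lra. Qed.

Lemma split_energy_arith (E1 EG x y z : F) :
  (E1 + EG) * y <= z -> E1 * (x + y) + EG * y <= E1 * x + z.
Proof. by lra. Qed.

Lemma excited_weight_arith (E0 E1 EG k x y : F) :
  E0 < E1 -> x <= E0 + k -> E1 + EG * y <= x -> EG * y <= k.
Proof. by lra. Qed.

Lemma quarter_arith (EG k y : F) :
  0 < EG -> EG * y <= k -> k <= EG / 4 -> y <= 1 / 4.
Proof. by move=> h h1 h2; rewrite -(ler_pM2l h); lra. Qed.

(** Here [z] and [t] are the weights of Psi off and on the line of Phi1, and [x], [y] are the weight
    of a vector on that line and its total weight: [t >= 3/4] against [z <= 1/4] gives the factor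
    3. *)
Lemma overlap_arith (x y z t : F) :
  0 <= x -> 0 <= y -> t * x <= z * y -> z <= 1 / 4 -> t + z = 1 -> 3 * x <= y.
Proof. by nra. Qed.

Lemma gap_arith (E0 E1 EG x y z w : F) :
  0 <= x -> 0 < EG -> E0 < E1 -> w = x + y -> 3 * x <= w ->
  E1 * w + EG * y <= z -> EG / 2 * w <= z - E0 * w.
Proof.
move=> x0 EG0 E01 -> b2 hw; have : 0 <= EG * y - EG / 2 * (x + y) by nra.
have : 0 <= (E1 - E0) * (x + y) by nra.
by lra.
Qed.

Lemma pythagoras_arith (x y z t w : F) :
  0 <= x -> 0 <= t -> z = x + y -> y = t + w -> w <= z.
Proof. by lra. Qed.

Lemma residual_energy_arith (E0 k x y z w u v : F) :
  z = x + y -> 2 * u <= 2 * k * z -> E0 * x + v - E0 * z = w ->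
  2 * (v - E0 * y) + 2 * u <= 2 * w + 2 * k * z.
Proof. by move=> -> h <-; lra. Qed.

Lemma residual_Phi0_arith (E0 EG k e b x y z : F) :
  0 <= k -> 0 <= b -> 0 <= e -> x <= b -> y - E0 * x <= e / 2 ->
  EG / 2 * z <= 2 * (y - E0 * x) + 2 * k * x -> EG * z <= 4 * e + 18 * k * b.
Proof. by nra. Qed.

Lemma residual_Phi1_arith (E0 E1 EG k e b x y z : F) :
  0 <= k -> 0 <= x -> x <= b -> E0 < E1 -> E1 - E0 <= k ->
  y - E1 * x <= e / 2 ->
  EG / 2 * z <= 2 * (y - E0 * x) + 2 * k * x -> EG * z <= 2 * e + 8 * k * b.
Proof. by nra. Qed.

Lemma sqr_combination_le (r s t g : F) :
  0 <= r -> 0 <= s -> 0 <= t -> 0 <= g -> g <= 1 -> r <= g * s + t ->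
  r ^+ 2 <= 2 * s ^+ 2 + 2 * t ^+ 2.
Proof.
move=> r0 s0 t0 g0 g1 h; have rst : r <= s + t by nra.
by have := sqr_ge0 (s - t); nra.
Qed.

Lemma residual_eta_arith (EG k b x y : F) :
  0 <= b -> 0 < EG -> EG * x <= k -> y <= b * x -> EG * y <= k * b.
Proof. by nra. Qed.

Lemma residual_Psi_arith (EG k e b x y z : F) :
  0 < EG -> z <= 2 * x + 2 * y -> EG * x <= 2 * e + 8 * k * b ->
  EG * y <= k * b -> EG * z <= 4 * e + 18 * k * b.
Proof. by nra. Qed.

End EnergyArithmetic.

(* The component of v orthogonal to u and w, when these are orthonormal. *)
Definition residual (R : realType) (n : nat) (u w v : 'cV[R[i]]_n) :=
  v - inner u v *: u - inner w v *: w.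

Section LowEnergy.
Variables (R : realType) (n : nat) (H : 'M[R[i]]_n).
Implicit Types (u v w : 'cV[R[i]]_n) (A B : 'M[R[i]]_n).

Lemma inner_normalized v : l2norm v = 1 -> inner v v = 1.
Proof. by move=> v1; rewrite innervv v1 expr1n. Qed.

Lemma inner_eq0J v w : inner v w = 0 -> inner w v = 0.
Proof. by move=> h; rewrite innerJ h rmorph0. Qed.

Lemma eigenvectors_orthogonal (x y : R) u v : H \is hermsymmx ->
  H *m u = x%:C *: u -> H *m v = y%:C *: v -> x != y -> inner u v = 0.
Proof.
move=> hH hu hv xy; have := inner_herm u v hH.
rewrite hu hv innerZl innerZr conj_real => /eqP; rewrite -subr_eq0 -mulrBl.
by rewrite mulf_eq0 -rmorphB /= fmorph_eq0 subr_eq0 (negPf xy) => /eqP.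
Qed.

(** The cross terms vanish because [H] is hermitian and maps [u] to a multiple of itself. *)
Lemma split_eigenvector (E : R) u v : H \is hermsymmx ->
  H *m u = E%:C *: u -> l2norm u = 1 ->
  let b := inner u v in
  let v' := v - b *: u in
  [/\ inner u v' = 0, l2norm v ^+ 2 = Normc.normc b ^+ 2 + l2norm v' ^+ 2
    & complex.Re (inner v (H *m v))
        = E * Normc.normc b ^+ 2 + complex.Re (inner v' (H *m v'))].
Proof.
move=> hH hu u1 b v'.
have uv' : inner u v' = 0.
  by rewrite innerDr innerNr innerZr inner_normalized // mulr1 subrr.
have vE : v = b *: u + v' by rewrite addrC subrK.
have v'u := inner_eq0J uv'.
have v'Hu : inner v' (H *m u) = 0 by rewrite hu innerZr v'u mulr0.
have uHv' : inner u (H *m v') = 0.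
  by rewrite -inner_herm // hu innerZl uv' mulr0.
clearbody v' b.
split=> //.
  apply: complexI; rewrite -innervv vE innerDl !innerDr !innerZl !innerZr.
  rewrite uv' v'u inner_normalized // !mulr0 addr0 add0r mulr1.
  by rewrite mulJc innervv rmorphD.
rewrite {1 2}vE mulmxDr -scalemxAr innerDl !innerDr !innerZl !innerZr.
rewrite v'Hu uHv' !mulr0 addr0 add0r hu innerZr inner_normalized // mulr1.
by rewrite mulrA mulJc -rmorphM ReD /= mulrC.
Qed.

(** Expanding gives 2 B H B - B B H - H B B, and in the last two terms [H] acts on [v] and becomes
    [E]. *)
Lemma double_commutator_form (E : R) v B : H \is hermsymmx -> B \is hermsymmx ->
  H *m v = E%:C *: v ->
  complex.Re (inner v (commutator B (commutator H B) *m v))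
    = 2 * (complex.Re (inner (B *m v) (H *m (B *m v)))
           - E * l2norm (B *m v) ^+ 2).
Proof.
move=> hH hB hv; rewrite /commutator !(mulmxBl, mulmxBr) -!mulmxA.
rewrite !(innerDr, innerNr) hv.
rewrite -!scalemxAr !innerZr -(inner_herm v _ hH) hv innerZl conj_real.
rewrite -!(inner_herm v _ hB) innervv -rmorphM !(ReD, ReN) /=.
by ring.
Qed.

Lemma double_commutator_energy (E b : R) v B :
  H \is hermsymmx -> B \is hermsymmx -> H *m v = E%:C *: v -> l2norm v = 1 ->
  opbound b (commutator B (commutator H B)) ->
  complex.Re (inner (B *m v) (H *m (B *m v))) - E * l2norm (B *m v) ^+ 2
    <= b / 2.
Proof.
move=> hH hB hv v1 hb; have := double_commutator_form hH hB hv.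
have := le_trans (Re_le_normc _) (opbound_inner v hb).
by rewrite v1 expr1n mulr1; lra.
Qed.

Variables (E0 E1 EG : R) (Phi0 Phi1 : 'cV[R[i]]_n).
Hypotheses (hH : H \is hermsymmx) (E01 : E0 < E1) (EG0 : 0 < EG).
Hypotheses (nd0 : nondegenerate_eigenvalue H E0)
  (nd1 : nondegenerate_eigenvalue H E1).
Hypotheses (ev0 : normalized_eigenstate H E0 Phi0)
  (ev1 : normalized_eigenstate H E1 Phi1).
Hypothesis gap : forall E', is_eigenvalue H E' -> E' != E0 -> E' != E1 ->
  EG <= E' - E1.

Let HPhi0 : H *m Phi0 = E0%:C *: Phi0 := proj1 ev0.
Let HPhi1 : H *m Phi1 = E1%:C *: Phi1 := proj1 ev1.
Let nPhi0 : l2norm Phi0 = 1 := proj2 ev0.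
Let nPhi1 : l2norm Phi1 = 1 := proj2 ev1.

Lemma l2norm1_neq0 v : l2norm v = 1 -> v != 0.
Proof.
move=> v1; apply/eqP => v0; move: v1.
rewrite v0 -(scale0r 0) l2normZ normc_real normr0 mul0r => /eqP.
by rewrite eq_sym oner_eq0.
Qed.

Lemma eigenvalue_of_eigenvector (x : R) f :
  H *m f = x%:C *: f -> l2norm f = 1 -> is_eigenvalue H x.
Proof.
move=> hf f1; apply/eigenvalueP; exists f^T.
  by rewrite -trmx_mul hf linearZ.
by rewrite trmx_eq0 l2norm1_neq0.
Qed.

Let orth0 f v : H *m f = E0%:C *: f -> inner Phi0 v = 0 -> inner f v = 0.
Proof.
move=> hf h; have Phi_neq0 := l2norm1_neq0 nPhi0.
have [a ->] := nondegenerate_colinear nd0 hf HPhi0 Phi_neq0.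
by rewrite innerZl h mulr0.
Qed.

Let orth1 f v : H *m f = E1%:C *: f -> inner Phi1 v = 0 -> inner f v = 0.
Proof.
move=> hf h; have Phi_neq0 := l2norm1_neq0 nPhi1.
have [a ->] := nondegenerate_colinear nd1 hf HPhi1 Phi_neq0.
by rewrite innerZl h mulr0.
Qed.

(** That E0 is the lowest level comes from the gap: an eigenvalue below E0 would differ from E0 and
    E1 and yet lie below E1. *)
Lemma ground_energy_le v :
  E0 * l2norm v ^+ 2 <= complex.Re (inner v (H *m v)).
Proof.
apply: spectral_lower_bound => // x f hf f1 xE0.
have x0 : x != E0 by rewrite lt_eqF.
have x1 : x != E1 by rewrite lt_eqF // (lt_trans xE0).
have := gap (eigenvalue_of_eigenvector hf f1) x0 x1.
by rewrite leNgt (lt_trans _ EG0) // subr_lt0 (lt_trans xE0).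
Qed.

Lemma first_excited_energy_le v : inner Phi0 v = 0 ->
  E1 * l2norm v ^+ 2 <= complex.Re (inner v (H *m v)).
Proof.
move=> h0; apply: spectral_lower_bound => // x f hf f1 xE1.
have [x0|x0] := eqVneq x E0; first by rewrite x0 in hf; exact: orth0 hf h0.
have x1 : x != E1 by rewrite lt_eqF.
have := gap (eigenvalue_of_eigenvector hf f1) x0 x1.
by rewrite leNgt (lt_trans _ EG0) // subr_lt0.
Qed.

(** Nondegeneracy turns orthogonality to Phi0 and Phi1 into orthogonality to every eigenvector of
    these two levels. *)
Lemma higher_energy_le v : inner Phi0 v = 0 -> inner Phi1 v = 0 ->
  (E1 + EG) * l2norm v ^+ 2 <= complex.Re (inner v (H *m v)).
Proof.
move=> h0 h1; apply: spectral_lower_bound => // x f hf f1 xE.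
have [x0|x0] := eqVneq x E0; first by rewrite x0 in hf; exact: orth0 hf h0.
have [x1|x1] := eqVneq x E1; first by rewrite x1 in hf; exact: orth1 hf h1.
have := gap (eigenvalue_of_eigenvector hf f1) x0 x1.
by rewrite leNgt ltrBlDl xE.
Qed.

(* Psi is a trial state for the first excited state; kappa bounds its excitation
   energy, hence also E1 - E0 and, through the gap, the distance of Psi from the
   line of Phi1. *)
Variables (kappa : R) (Psi : 'cV[R[i]]_n).
Hypotheses (nPsi : l2norm Psi = 1) (Phi0Psi : inner Phi0 Psi = 0).
Hypothesis ePsi : complex.Re (inner Psi (H *m Psi)) <= E0 + kappa.
Hypothesis kappa_small : kappa <= EG / 4.

Lemma gap01_le : E1 - E0 <= kappa.
Proof.
have := first_excited_energy_le Phi0Psi; rewrite nPsi expr1n mulr1 => h.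
exact: level_spacing_arith h ePsi.
Qed.

Let kappa0 : 0 <= kappa.
Proof. by rewrite (le_trans _ gap01_le) // subr_ge0 ltW. Qed.

Let c := inner Phi1 Psi.
Let eta := Psi - c *: Phi1.

Let Phi01 : inner Phi0 Phi1 = 0.
Proof. by apply: eigenvectors_orthogonal HPhi0 HPhi1 _; rewrite // lt_eqF. Qed.

Lemma split_first_excited v : inner Phi0 v = 0 ->
  let b := inner Phi1 v in
  let v' := v - b *: Phi1 in
  l2norm v ^+ 2 = Normc.normc b ^+ 2 + l2norm v' ^+ 2 /\
  E1 * l2norm v ^+ 2 + EG * l2norm v' ^+ 2 <= complex.Re (inner v (H *m v)).
Proof.
move=> h0 b v'; case: (split_eigenvector v hH HPhi1 nPhi1) => o nv ->.
split=> //; rewrite nv -/b -/v'.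
have : inner Phi0 v' = 0.
  by rewrite innerDr innerNr innerZr Phi01 mulr0 h0 subrr.
by move=> /higher_energy_le/(_ o); exact: split_energy_arith.
Qed.

Let eta_small : EG * l2norm eta ^+ 2 <= kappa.
Proof.
have [_] := split_first_excited Phi0Psi; rewrite nPsi expr1n mulr1 -/c -/eta.
exact: excited_weight_arith E01 ePsi.
Qed.

Let c_eta : Normc.normc c ^+ 2 + l2norm eta ^+ 2 = 1.
Proof. by have [<- _] := split_first_excited Phi0Psi; rewrite nPsi expr1n. Qed.

(** Psi lies mostly along Phi1, so a vector orthogonal to Psi has at most a third of its weight on
    Phi1. The other two thirds lie above the gap, which leaves more than EG / 2. *)
Lemma gap_orthogonal w : inner Phi0 w = 0 -> inner Psi w = 0 ->
  EG / 2 * l2norm w ^+ 2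
    <= complex.Re (inner w (H *m w)) - E0 * l2norm w ^+ 2.
Proof.
move=> w0 wPsi; have [nw hw] := split_first_excited w0.
set b := inner Phi1 w in nw hw; set w' := w - _ in nw hw.
(* Orthogonality to [Psi = c Phi1 + eta] trades the overlap with Phi1 for the overlap with the small
   vector [eta]. *)
have cb : Normc.normc c * Normc.normc b <= l2norm eta * l2norm w.
  rewrite -normcJ -Normc.normcM.
  suff -> : c^* * b = - inner eta w by rewrite normcN; exact: cauchy_schwarz.
  by rewrite innerDl innerNl innerZl wPsi add0r opprK.
have eta4 : l2norm eta ^+ 2 <= 1 / 4 := quarter_arith EG0 eta_small kappa_small.
have cb2 : Normc.normc c ^+ 2 * Normc.normc b ^+ 2
    <= l2norm eta ^+ 2 * l2norm w ^+ 2.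
  by rewrite -!exprMn ler_sqr ?nnegrE ?mulr_ge0 ?l2norm_ge0 ?normc_ge0.
have b2 := overlap_arith (sqr_ge0 _) (sqr_ge0 _) cb2 eta4 c_eta.
exact: gap_arith (sqr_ge0 _) EG0 E01 nw b2 hw.
Qed.

Let K := H - E0%:C%:M.

Let KE v : complex.Re (inner v (K *m v))
  = complex.Re (inner v (H *m v)) - E0 * l2norm v ^+ 2.
Proof.
rewrite mulmxBl innerDr innerNr mul_scalar_mx innerZr innervv -rmorphM.
by rewrite ReD ReN.
Qed.

Let psdK : psd K.
Proof. by move=> v; rewrite KE subr_ge0 ground_energy_le. Qed.

Local Notation res := (residual Phi0 Psi).

Lemma residual_comb a u v : res (a *: u + v) = a *: res u + res v.
Proof.
by rewrite /residual !innerDr !innerZr; apply/colP => k; rewrite !mxE; ring.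
Qed.

Let res_Phi0 v : inner Phi0 (res v) = 0.
Proof.
rewrite /residual !(innerDr, innerNr, innerZr) Phi0Psi inner_normalized //.
by rewrite mulr1 mulr0 !subrr.
Qed.

Let res_Psi v : inner Psi (res v) = 0.
Proof.
rewrite /residual !(innerDr, innerNr, innerZr) (inner_eq0J Phi0Psi).
rewrite inner_normalized //.
by rewrite mulr1 mulr0 subr0 subrr.
Qed.

Lemma l2norm_residual u v : l2norm u = 1 ->
  l2norm v ^+ 2 = Normc.normc (inner u v) ^+ 2
                  + l2norm (v - inner u v *: u) ^+ 2.
Proof.
move=> u1; apply: complexI; rewrite -innervv.
set b := inner u v; set v' := v - _.
have -> : (Normc.normc b ^+ 2 + l2norm v' ^+ 2)%:C = b^* * b + inner v' v'.
  by rewrite mulJc innervv rmorphD.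
rewrite /v' /b !(innerDl, innerDr, innerNl, innerNr, innerZl, innerZr).
by rewrite (inner_normalized u1) (innerJ u v); ring.
Qed.

Let res_le v : l2norm (res v) <= l2norm v.
Proof.
rewrite -ler_sqr ?nnegrE ?l2norm_ge0 //.
have := l2norm_residual (v - inner Phi0 v *: Phi0) nPsi.
rewrite innerDr innerNr innerZr (inner_eq0J Phi0Psi) mulr0 subr0.
exact: pythagoras_arith (sqr_ge0 _) (sqr_ge0 _) (l2norm_residual v nPhi0).
Qed.

(** Measured from E0, removing the Phi0 component costs nothing, and removing the Psi component
    costs at most [kappa] times its weight. The factors 2 come from [psd_seminorm_add] for the
    positive form [K]. *)
Let res_energy v : EG / 2 * l2norm (res v) ^+ 2
  <= 2 * (complex.Re (inner v (H *m v)) - E0 * l2norm v ^+ 2)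
     + 2 * kappa * l2norm v ^+ 2.
Proof.
apply: le_trans (gap_orthogonal (res_Phi0 v) (res_Psi v)) _.
case: (split_eigenvector v hH HPhi0 nPhi0) => o nv hv.
set v' := v - _ in o nv hv.
rewrite -KE -[res v]/(v' - inner Psi v *: Psi).
apply: le_trans (psd_seminorm_add _ _ psdK) _; rewrite (KE v').
apply: residual_energy_arith nv _ _; last first.
  by rewrite hv.
rewrite -mulrA ler_pM2l // KE -scaleNr l2normZ nPsi mulr1 -scalemxAr.
rewrite innerZl innerZr mulrA mulJc ReM_real normcN mulrC -mulrBl.
apply: ler_pM; rewrite ?sqr_ge0 //.
  by have := ground_energy_le Psi; rewrite nPsi expr1n mulr1 subr_ge0.
  by rewrite lerBlDl ePsi.
rewrite ler_sqr ?nnegrE ?l2norm_ge0 ?normc_ge0 //.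
by have := cauchy_schwarz Psi v; rewrite nPsi mul1r.
Qed.

(* For an exact eigenvector Phi the energy of B Phi above that of Phi is half
   the double commutator; the gap turns it into a bound on the part of B Phi
   outside span(Phi0, Psi).  Psi is only approximately an eigenvector, so B Psi
   is compared with B Phi1. *)
Lemma residual_bound B (b e : R) : B \is hermsymmx -> 0 <= b -> opbound b B ->
  opbound e (commutator B (commutator H B)) ->
  EG * l2norm (res (B *m Phi0)) ^+ 2 <= 4 * e + 18 * kappa * b ^+ 2 /\
  EG * l2norm (res (B *m Psi)) ^+ 2 <= 4 * e + 18 * kappa * b ^+ 2.
Proof.
move=> hB b0 hb he.
have nB v : l2norm v = 1 -> l2norm (B *m v) ^+ 2 <= b ^+ 2.
  move=> v1; rewrite ler_sqr ?nnegrE ?l2norm_ge0 //.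
  by have := hb v; rewrite v1 mulr1.
have e0 : 0 <= e.
  by have := le_trans (l2norm_ge0 _) (he Phi0); rewrite nPhi0 mulr1.
have b2 := sqr_ge0 b; split.
  apply: residual_Phi0_arith kappa0 b2 e0 (nB _ nPhi0) _ (res_energy _).
  exact: double_commutator_energy hH hB HPhi0 nPhi0 he.
(* Measuring from E0 instead of E1 adds at most [kappa * b ^+ 2] to the energy, hence 8 in place of
   4. *)
have r1 : EG * l2norm (res (B *m Phi1)) ^+ 2 <= 2 * e + 8 * kappa * b ^+ 2.
  apply: residual_Phi1_arith kappa0 (sqr_ge0 _) (nB _ nPhi1) E01 gap01_le _ (res_energy _).
  exact: double_commutator_energy hH hB HPhi1 nPhi1 he.
have -> : B *m Psi = c *: (B *m Phi1) + B *m eta.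
  by rewrite /eta mulmxBr -scalemxAr addrC subrK.
(* The bound for Psi is twice [2 e + 8 kappa b^2] plus [2 kappa b^2] from [eta], and this gives the
   common constant of the statement. *)
rewrite residual_comb; apply: residual_Psi_arith EG0 _ r1 _.
  apply: (@sqr_combination_le _ _ _ (l2norm (res (B *m eta))) (Normc.normc c));
    rewrite ?l2norm_ge0 ?normc_ge0 //.
    rewrite -(@expr_le1 _ 2) ?normc_ge0 // -c_eta lerDl.
    exact: sqr_ge0.
  by rewrite -l2normZ l2normD.
apply: residual_eta_arith b2 EG0 eta_small _.
rewrite -exprMn ler_sqr ?nnegrE ?mulr_ge0 ?l2norm_ge0 //.
exact: le_trans (res_le _) (hb _).
Qed.

End LowEnergy.

Section VarianceArithmetic.
Variable F : realFieldType.

Lemma sqr_le_add (x y z : F) :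
  0 <= x -> x <= y + z -> x ^+ 2 <= 2 * y ^+ 2 + 2 * z ^+ 2.
Proof.
move=> x0 h; apply: (@le_trans _ _ ((y + z) ^+ 2)).
  by rewrite ler_sqr ?nnegrE // (le_trans x0).
by have := sqr_ge0 (y - z); nra.
Qed.

(** [X] is the deviation, [r] the part outside the plane before the factor [s], with pieces [r0],
    [r1]; [be] is the off-diagonal element and [z] the norm of [zeta]. As [2 s^2 = 1],
    [X^2 <= r^2 + 2 be^2], where [r^2 <= 4 P / EG]. *)
Lemma variance_arith (X s r r0 r1 P Q EG M b c z be : F) :
  0 <= X -> 0 <= r -> 0 <= be -> 0 < EG -> 0 < M -> s * s * 2 = 1 ->
  X <= s * r + be -> r <= r0 + r1 -> EG * r0 ^+ 2 <= P -> EG * r1 ^+ 2 <= P ->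
  2 * M * be <= c + 2 * b * z -> EG * z ^+ 2 <= Q ->
  X ^+ 2 <= 4 * P / EG + (c ^+ 2 + 4 * b ^+ 2 * Q / EG) / M ^+ 2.
Proof.
move=> X0 r_0 be0 EG0 M0 ss hX hr h0 h1 hb hz.
have {hX} := sqr_le_add X0 hX; have {hr} := sqr_le_add r_0 hr.
have Mb0 : 0 <= 2 * M * be by rewrite !mulr_ge0 // ltW.
have {hb} := sqr_le_add Mb0 hb.
rewrite !exprMn => hbe hr.
rewrite mulrA {2}expr2 [2 * (s * s)]mulrC ss mul1r => hX.
have b2 := sqr_ge0 b.
have {}h0 : r0 ^+ 2 <= P / EG by rewrite ler_pdivlMr // mulrC.
have {}h1 : r1 ^+ 2 <= P / EG by rewrite ler_pdivlMr // mulrC.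
have {}hz : z ^+ 2 <= Q / EG by rewrite ler_pdivlMr // mulrC.
have {}hz : b ^+ 2 * z ^+ 2 <= b ^+ 2 * (Q / EG) by rewrite ler_wpM2l.
apply: (@le_trans _ _ (4 * (P / EG) + 2 * be ^+ 2)); first by lra.
rewrite mulrA lerD2l ler_pdivlMr ?exprn_gt0 //.
have -> : 4 * b ^+ 2 * Q / EG = 4 * (b ^+ 2 * (Q / EG)) by rewrite !mulrA.
have -> : 2 * be ^+ 2 * M ^+ 2 = 2 ^+ 2 * M ^+ 2 * be ^+ 2 / 2 by field.
rewrite -!(mulrA (2 ^+ 2)) in hbe *; move: hz hbe.
move: (M ^+ 2 * be ^+ 2) (b ^+ 2 * z ^+ 2) (b ^+ 2 * (Q / EG)) => x y t hz hbe.
by lra.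
Qed.

End VarianceArithmetic.

(** * Fluctuations in the symmetry-breaking superposition *)

Section SymmetryBreaking.
Variables (R : realType) (n : nat) (H O : 'M[R[i]]_n).
Variables (E0 E1 EG bO dO : R) (Phi0 Phi1 : 'cV[R[i]]_n).
Hypotheses (hH : H \is hermsymmx) (hO : O \is hermsymmx).
Hypotheses (E01 : E0 < E1) (EG0 : 0 < EG).
Hypotheses (nd0 : nondegenerate_eigenvalue H E0)
  (nd1 : nondegenerate_eigenvalue H E1).
Hypotheses (ev0 : normalized_eigenstate H E0 Phi0)
  (ev1 : normalized_eigenstate H E1 Phi1).
Hypothesis gap : forall E', is_eigenvalue H E' -> E' != E0 -> E' != E1 ->
  EG <= E' - E1.
Hypotheses (O1 : inner Phi0 (O *m Phi0) = 0)
  (O3 : inner Phi0 (O *m (O *m (O *m Phi0))) = 0).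
Hypotheses (bO0 : 0 <= bO) (hbO : opbound bO O)
  (hdO : opbound dO (commutator O (commutator H O))).

Variables (M s kappa : R) (Psi Xi Xi' : 'cV[R[i]]_n).
Hypotheses (ME : M = l2norm (O *m Phi0)) (M0 : 0 < M).
Hypotheses (sE : s = (Num.sqrt 2)^-1) (kappaE : kappa = dO / (2 * M ^+ 2)).
Hypothesis PsiE : Psi = (M^-1)%:C *: (O *m Phi0).
Hypothesis XiE : Xi = s%:C *: (Phi0 + Psi).
Hypothesis kappa_small : kappa <= EG / 4.

Let HPhi0 : H *m Phi0 = E0%:C *: Phi0 := proj1 ev0.
Let nPhi0 : l2norm Phi0 = 1 := proj2 ev0.

Let OPhi0 : O *m Phi0 = M%:C *: Psi.
Proof. by rewrite PsiE scalerA -rmorphM divff ?lt0r_neq0 // scale1r. Qed.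

Lemma l2norm_Psi : l2norm Psi = 1.
Proof.
rewrite PsiE l2normZ normc_real ger0_norm ?invr_ge0 ?ltW // -ME.
by rewrite mulVf ?lt0r_neq0.
Qed.

Lemma Phi0_Psi : inner Phi0 Psi = 0.
Proof. by rewrite PsiE innerZr O1 mulr0. Qed.

(** Origin of [kappa]: the excess of the unnormalized [O Phi0] is at most [dO / 2], and normalizing
    divides it by [M ^+ 2]. *)
Lemma energy_Psi : complex.Re (inner Psi (H *m Psi)) <= E0 + kappa.
Proof.
have := double_commutator_energy hH hO HPhi0 nPhi0 hdO.
rewrite OPhi0 l2normZ l2norm_Psi mulr1 normc_real gtr0_norm //.
rewrite -scalemxAr innerZl innerZr conj_real !ReM_real mulrA -expr2 mulrC.
rewrite -mulrBl.
rewrite -ler_pdivlMr ?exprn_gt0 // lerBlDl; congr (_ <= _ + _).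
by rewrite kappaE -mulrA -invfM.
Qed.

Lemma kappa_ge0 : 0 <= kappa.
Proof.
have := first_excited_energy_le hH EG0 nd0 ev0 gap Phi0_Psi.
rewrite l2norm_Psi expr1n mulr1 => h.
have := le_trans (le_trans (ltW E01) h) energy_Psi.
by rewrite lerDl.
Qed.

Let ss : s * s * 2 = 1.
Proof. by rewrite sE -expr2 exprVn sqr_sqrtr // mulVf. Qed.

Let s2 : s%:C * s%:C * 2 = 1 :> R[i].
Proof. by rewrite -[2](rmorph_nat (real_complex R)) -!rmorphM ss. Qed.

Let s1 : 0 <= s <= 1.
Proof.
rewrite sE invr_ge0 sqrtr_ge0 /= invf_le1 ?sqrtr_gt0 //.
by rewrite -[X in X <= _]sqrtr1 ler_sqrt // ler1n.
Qed.

Lemma l2norm_Xi : l2norm Xi = 1.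
Proof.
apply/eqP; rewrite -(@eqrXn2 _ 2) ?l2norm_ge0 // expr1n; apply/eqP/complexI.
rewrite -innervv XiE innerZl innerZr conj_real innerDl !innerDr Phi0_Psi.
rewrite (inner_eq0J Phi0_Psi) !inner_normalized ?l2norm_Psi //.
by rewrite addr0 add0r mulrA -[X in _ * X]/(2 : R[i]) s2.
Qed.

(** There are no cross terms, since Phi0 is an eigenvector orthogonal to Psi; the energy of Xi is
    the mean of E0 and that of Psi. *)
Lemma energy_Xi : E0 <= complex.Re (inner Xi (H *m Xi)) <= E0 + kappa.
Proof.
have := ground_energy_le hH E01 EG0 gap Xi.
rewrite l2norm_Xi expr1n mulr1 => -> /=.
have hP : inner Psi (H *m Phi0) = 0.
  by rewrite HPhi0 innerZr (inner_eq0J Phi0_Psi) mulr0.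
have hP' : inner Phi0 (H *m Psi) = 0.
  by rewrite -(inner_herm _ _ hH) HPhi0 innerZl Phi0_Psi mulr0.
rewrite XiE -scalemxAr innerZl innerZr conj_real mulrA -rmorphM ReM_real -expr2.
rewrite sE exprVn sqr_sqrtr // mulmxDr innerDl !innerDr hP hP' HPhi0 innerZr.
rewrite inner_normalized // mulr1 addr0 add0r ReD mulrC ler_pdivrMr //=.
move: energy_Psi kappa_ge0; move: kappa (complex.Re _) => k x h k0.
by rewrite mulr_natr mulr2n addrACA -addrA lerD2l (le_trans h) // lerD2l lerDl.
Qed.

Variables (B : 'M[R[i]]_n) (b e cB : R).
Hypotheses (hB : B \is hermsymmx) (b0 : 0 <= b) (hb : opbound b B)
  (he : opbound e (commutator B (commutator H B)))
  (hc : opbound cB (commutator O B)).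

Hypothesis Xi'E : Xi' = s%:C *: (Phi0 - Psi).

Let nXi' : l2norm Xi' = 1.
Proof.
apply/eqP; rewrite -(@eqrXn2 _ 2) ?l2norm_ge0 // expr1n; apply/eqP/complexI.
rewrite -innervv Xi'E innerZl innerZr conj_real innerDl !innerDr.
rewrite !(innerNl, innerNr).
rewrite Phi0_Psi (inner_eq0J Phi0_Psi) !inner_normalized ?l2norm_Psi //.
by rewrite !oppr0 addr0 add0r opprK mulrA -[X in _ * X]/(2 : R[i]) s2.
Qed.

Variable zeta : 'cV[R[i]]_n.
Hypothesis zetaE : zeta = residual Phi0 Psi (O *m Psi).

(** The Phi0 coefficient is [M] because [O] is hermitian; the Psi coefficient is the third moment
    divided by [M ^+ 2], which is zero. *)
Let OPsi : O *m Psi = M%:C *: Phi0 + zeta.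
Proof.
rewrite zetaE /residual.
have -> : inner Phi0 (O *m Psi) = M%:C.
  rewrite -(inner_herm _ _ hO) OPhi0 innerZl conj_real.
  rewrite inner_normalized ?mulr1 //.
  exact: l2norm_Psi.
have -> : inner Psi (O *m Psi) = 0.
  rewrite PsiE -scalemxAr innerZl innerZr (inner_herm _ _ hO) O3.
  by rewrite !mulr0.
by rewrite scale0r subr0 addrC subrK.
Qed.

Let OXi : O *m Xi = M%:C *: Xi + s%:C *: zeta.
Proof.
rewrite XiE -scalemxAr mulmxDr OPhi0 OPsi; apply/colP => k; rewrite !mxE.
by ring.
Qed.

Let OXi' : O *m Xi' = - (M%:C *: Xi' + s%:C *: zeta).
Proof.
rewrite Xi'E -scalemxAr mulmxBr OPhi0 OPsi; apply/colP => k; rewrite !mxE.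
by ring.
Qed.


Variable beta : R[i].
Hypothesis betaE : beta = inner Xi' (B *m Xi).

(* Xi and Xi' are eigenvectors of O for M and - M up to the small vector zeta,
   while O almost commutes with B: the matrix element beta of B between them is
   therefore small. *)
Let beta_eq : 2 * M%:C * beta = - (inner Xi' (commutator O B *m Xi)
  + s%:C * inner zeta (B *m Xi)
  + s%:C * inner Xi' (B *m zeta)).
Proof.
rewrite mulmxBl -!mulmxA innerDr innerNr -(inner_herm Xi' _ hO) OXi OXi'.
rewrite mulmxDr -!scalemxAr innerNl innerDl innerDr !innerZl !innerZr.
rewrite !conj_real.
by rewrite -betaE; ring.
Qed.

Let beta_le : 2 * M * Normc.normc beta <= cB + 2 * b * l2norm zeta.
Proof.
have := congr1 (@Normc.normc R) beta_eq.
rewrite normcN !Normc.normcM normc_real (gtr0_norm M0).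
have -> : Normc.normc (2 : R[i]) = 2.
  by rewrite -(normr_nat R 2) -normc_real rmorph_nat.
move=> ->; apply: le_trans (normcD _ _) _.
have s_le z : Normc.normc (s%:C * z) <= Normc.normc z :> R.
  have /andP[s0 s1'] := s1; rewrite Normc.normcM normc_real ger0_norm //.
  by rewrite -[leRHS]mul1r ler_wpM2r ?normc_ge0.
have -> : cB + 2 * b * l2norm zeta = (cB + b * l2norm zeta) + b * l2norm zeta.
  by ring.
apply: lerD; last first.
  apply: le_trans (s_le _) _; apply: le_trans (cauchy_schwarz _ _) _.
  by rewrite nXi' mul1r.
apply: le_trans (normcD _ _) _; apply: lerD.
  apply: le_trans (cauchy_schwarz _ _) _; rewrite nXi' mul1r.
  by have := hc Xi; rewrite l2norm_Xi mulr1.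
apply: le_trans (s_le _) _; apply: le_trans (cauchy_schwarz _ _) _.
rewrite mulrC ler_wpM2r ?l2norm_ge0 //.
by have := hb Xi; rewrite l2norm_Xi mulr1.
Qed.

Let zeta_le : EG * l2norm zeta ^+ 2 <= 4 * dO + 18 * kappa * bO ^+ 2.
Proof.
rewrite zetaE.
by have [] := residual_bound hH E01 EG0 nd0 nd1 ev0 ev1 gap l2norm_Psi Phi0_Psi
  energy_Psi kappa_small hO bO0 hbO hdO.
Qed.

Lemma variance_bound :
  l2norm (B *m Xi - inner Xi (B *m Xi) *: Xi) ^+ 2
    <= 4 * (4 * e + 18 * kappa * b ^+ 2) / EG
       + (cB ^+ 2 + 4 * b ^+ 2 * (4 * dO + 18 * kappa * bO ^+ 2) / EG) / M ^+ 2.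
Proof.
(* Xi and Xi' form an orthonormal basis of the plane, so removing the Xi component leaves the Xi'
   component and the part outside the plane. *)
have -> : B *m Xi - inner Xi (B *m Xi) *: Xi
    = residual Phi0 Psi (B *m Xi) + beta *: Xi'.
  rewrite betaE /residual; move: (B *m Xi) => v.
  rewrite XiE Xi'E !innerZl !conj_real innerDl innerDl innerNl.
  apply/colP => k; rewrite !mxE.
  (* The identity holds only because [2 s^2 = 1]; unit coefficients are inserted here to be replaced
     by that product. *)
  rewrite -[in RHS](mul1r (inner Phi0 v * _)).
  rewrite -[in RHS](mul1r (inner Psi v * _)).
  by rewrite -s2; ring.
have [r0 r1] := residual_bound hH E01 EG0 nd0 nd1 ev0 ev1 gap l2norm_Psi Phi0_Psi
  energy_Psi kappa_small hB b0 hb he.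
have -> : residual Phi0 Psi (B *m Xi) = s%:C *:
    (residual Phi0 Psi (B *m Phi0) + residual Phi0 Psi (B *m Psi)).
  rewrite XiE -scalemxAr mulmxDr /residual !innerZr !innerDr.
  move: (s%:C) (B *m Phi0) (B *m Psi) => a u v.
  move: (inner Phi0 u) (inner Phi0 v) (inner Psi u) (inner Psi v) => *.
  by apply/colP => k; rewrite !mxE; ring.
have h1 := l2normD (s%:C *: (residual Phi0 Psi (B *m Phi0)
  + residual Phi0 Psi (B *m Psi))) (beta *: Xi').
rewrite [l2norm (beta *: _)]l2normZ nXi' mulr1 in h1.
have /andP[s0 _] := s1.
apply: variance_arith (l2norm_ge0 _) (l2norm_ge0 _) (normc_ge0 beta) EG0 M0 ss _
  (l2normD _ _) r0 r1 beta_le zeta_le.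
rewrite -[X in _ <= X * _ + _](ger0_norm s0) -normc_real -l2normZ.
exact: h1.
Qed.

End SymmetryBreaking.

(** * The ground state energy density *)

Section ThermodynamicLimit.
Variables (R : realType) (d q : nat).

Lemma unit_vector (V : finType) : (0 < q)%N ->
  exists v : vec R q V, l2norm v = 1.
Proof.
move=> q0; pose s : config q V := [ffun => Ordinal q0].
by exists (delta_mx (enum_rank s) 0); exact: l2norm_delta.
Qed.

(** * Open boxes placed in a larger torus *)

Section Box.
Variables l M : nat.
Hypothesis lM : (l <= M)%N.

Definition box (a : torus d M) (y : torus d l) : torus d M :=
  a + [ffun i => inord (y i)].

Lemma box_inj a : injective (box a).
Proof.
move=> y z /addrI /ffunP h; apply/ffunP => i; apply: ord_inj.
have := h i; rewrite !ffunE => /(congr1 (@nat_of_ord _)).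
by rewrite !inordK // ltnS (leq_trans _ lM) // -ltnS.
Qed.

(* For x in bulk k and sites y with coordinates at most k in absolute value,
   x + y does not wrap around the torus. *)
Definition bulk (k : nat) : {set torus d l} :=
  [set x in ffun_on [pred j : 'I_l.+1 | (k <= j)%N && (j + k <= l)%N]]%SET.

(** For [x] in the bulk neither torus wraps around, so both compute the same integer coordinates. *)
Lemma box_site (S : {fset zd d}) (k : nat) (a : torus d M) (x : torus d l) :
  (forall y i, y \in S -> (`|y i| <= k)%N) -> x \in bulk k ->
  box a \o @site d l S x = @site d M S (box a x).
Proof.
move=> hk; rewrite inE => /ffun_onP xk; apply/funext => y /=.
rewrite /site /box -addrA; congr (_ + _); apply/ffunP => i; apply: ord_inj.
apply/eqP; rewrite -eqz_nat.
have /andP[k1 k2] := xk i; have := hk _ i (fsvalP y).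
have e1 : Posz ((x + to_torus l (fsval y))%R i) = Posz (x i) + fsval y i.
  rewrite [(x + _) i]ffunE /= -modz_nat PoszD to_torusE modzDmr modz_small //.
  move: k1 k2 (hk _ i (fsvalP y)); move: (fsval y i : int) (x i : nat) => u v.
  lia.
move=> hki; rewrite [X in Posz (nat_of_ord X) == _]ffunE inordK; last first.
  by rewrite ltnS (leq_trans _ lM) // -ltnS.
pose w : torus d M := [ffun i => inord (x i)].
have wi : w i = x i :> nat.
  by rewrite ffunE inordK // ltnS (leq_trans _ lM) // -ltnS.
have -> : Posz ((w + to_torus M (fsval y))%R i) = Posz (x i) + fsval y i.
  rewrite [(w + _)%R i]ffunE /= -modz_nat PoszD to_torusE modzDmr wi.
  rewrite modz_small //.
  move: k1 k2 hki lM; move: (fsval y i : int) (x i : nat) => u v.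
  lia.
by rewrite e1.
Qed.

End Box.

Lemma card_torus l : #|{: torus d l}| = (l.+1 ^ d)%N.
Proof. by rewrite card_ffun !card_ord. Qed.

Lemma card_bulk l k : ((l.+1 - k.*2) ^ d <= #|bulk l k|)%N.
Proof.
rewrite cardsE card_ffun_on card_ord; case: d => // d'; rewrite leq_exp2r //.
rewrite -[X in (X <= _)%N]card_ord.
pose f (j : 'I_(l.+1 - k.*2)) : 'I_l.+1 := inord (j + k).
have fE j : f j = (j + k)%N :> nat.
  by rewrite inordK //; have := ltn_ord j; lia.
rewrite -(card_imset predT (_ : injective f)); last first.
  move=> i j /(congr1 (@nat_of_ord _)); rewrite !fE => /addIn.
  exact: ord_inj.
apply/subset_leq_card/fintype.subsetP => _ /imsetP[j _ ->].
by rewrite inE /= fE; have := ltn_ord j; lia.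
Qed.

Lemma bernoulli (x : R) m : 0 <= x <= 1 -> 1 - m%:R * x <= (1 - x) ^+ m.
Proof.
move=> /andP[x0 x1]; elim: m => [|m ih]; first by rewrite mul0r subr0 expr0.
rewrite exprS; apply: (@le_trans _ _ ((1 - x) * (1 - m%:R * x))).
  rewrite -natr1; have : 0 <= m%:R * x * x by rewrite !mulr_ge0.
  by nra.
by rewrite ler_wpM2l // subr_ge0.
Qed.

(** Each of the [d] directions loses [2k] of its [l.+1] coordinates; Bernoulli's inequality adds up
    the losses. *)
Lemma bulk_fraction l k : (k.*2 <= l)%N ->
  1 - #|bulk l k|%:R / #|{: torus d l}|%:R <= (d * k.*2)%:R / l.+1%:R :> R.
Proof.
move=> kl; have l0 : 0 < l.+1%:R :> R by rewrite ltr0n.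
apply: (@le_trans _ _ (1 - (1 - k.*2%:R / l.+1%:R) ^+ d)).
  rewrite lerD2l lerN2 card_torus natrX ler_pdivlMr ?exprn_gt0 // -exprMn.
  rewrite mulrBl mul1r divfK ?lt0r_neq0 // -natrB ?(leq_trans kl) //.
  by rewrite -natrX ler_nat card_bulk.
rewrite lerBlDr -lerBlDl natrM -mulrA; apply: bernoulli.
by rewrite divr_ge0 //= ler_pdivrMr // mul1r ler_nat (leq_trans kl).
Qed.

Variables (S : {fset zd d}) (ho : op R q S) (c : R).
Hypotheses (q0 : (0 < q)%N) (hho : ho \is hermsymmx).
Hypotheses (c0 : 0 <= c) (hc : opbound c ho).

Let e l := @ground_energy_density R d q l S ho.
Let N l : R := #|{: torus d l}|%:R.

Let N0 l : 0 < N l.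
Proof. by rewrite /N card_torus ltr0n expn_gt0. Qed.

Lemma tau_sum_energy_le l (v : vec R q (torus d l)) :
  fits l S -> l2norm v = 1 ->
  - c <= (N l)^-1 * complex.Re (inner v (tau_sum l ho *m v)) <= c.
Proof.
move=> fS v1; have b := opbound_inner v (opbound_tau_sum fS c0 hc).
rewrite v1 expr1n mulr1 in b.
rewrite -ler_norml normrM gtr0_norm ?invr_gt0 // mulrC ler_pdivrMr //.
rewrite mulrC (le_trans _ b) // -(normc_real (complex.Re _)) -lecR -!normcE.
by apply: le_trans (normc_ge_Re _); rewrite normcE normc_real.
Qed.

Lemma ground_energy_density_le l (v : vec R q (torus d l)) : fits l S ->
  N l * e l * l2norm v ^+ 2 <= complex.Re (inner v (tau_sum l ho *m v)).
Proof.
move=> fS; have [v0|v0] := eqVneq (l2norm v) 0.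
  by rewrite (l2norm_eq0 v0) mulmx0 inner0r -(l2norm_eq0 v0) v0 expr0n mulr0.
have vp : 0 < l2norm v by rewrite lt_def v0 l2norm_ge0.
pose w := ((l2norm v)^-1)%:C *: v.
have w1 : l2norm w = 1.
  by rewrite l2normZ normc_real ger0_norm ?invr_ge0 ?l2norm_ge0 // mulVf.
have : e l <= (N l)^-1 * complex.Re (inner w (tau_sum l ho *m w)).
  apply: ge_inf; last by exists w.
  by exists (- c) => _ [u /= u1 <-]; have /andP[] := tau_sum_energy_le fS u1.
rewrite -scalemxAr innerZl innerZr conj_real mulrA -rmorphM ReM_real.
rewrite mulrC ler_pdivlMr // -expr2 exprVn mulrC ler_pdivlMl ?exprn_gt0 //.
by rewrite [N l * e l * _]mulrC.
Qed.

(** Unit vectors exist because [0 < q], so the default value of [inf] on the empty set does not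
    interfere. *)
Lemma le_ground_energy_density l (x : R) :
  (forall v, l2norm v = 1 ->
     x <= (N l)^-1 * complex.Re (inner v (tau_sum l ho *m v))) -> x <= e l.
Proof.
move=> h; apply: lb_le_inf => [|_ [v /= v1 <-]]; last exact: h.
have [v v1] := unit_vector (torus d l) q0.
by eexists; exists v; first exact: v1.
Qed.

Lemma ground_energy_density_bounded l : fits l S -> - c <= e l <= c.
Proof.
move=> fS; apply/andP; split.
  apply: le_ground_energy_density => v v1.
  by have /andP[] := tau_sum_energy_le fS v1.
have [v v1] := unit_vector (torus d l) q0.
have := ground_energy_density_le v fS; rewrite v1 expr1n mulr1.
rewrite -ler_pdivlMl // => h; apply: le_trans h _.
by have /andP[] := tau_sum_energy_le fS v1.
Qed.

(* Anderson's trick: averaging over all translates, in the torus of side M.+1,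
   of the Hamiltonian of an open box of side l.+1 gives a multiple of the full
   Hamiltonian, so the ground state energies compare without any trial state. *)
Lemma anderson_bound l M k : (l <= M)%N -> fits l S -> fits M S ->
  (forall y i, y \in S -> (`|y i| <= k)%N) ->
  N l * e l - (N l - #|bulk l k|%:R) * c <= #|bulk l k|%:R * e M.
Proof.
move=> lM fl fM hk; set lam := _ - _.
pose K : op R q (torus d l) := \sum_(x in bulk l k) embed (@site d l S x) ho.
have hK : K \is hermsymmx.
  apply: hermI; rewrite adjmx_sum; apply: eq_bigr => x _.
  by rewrite -embed_adj hermP.
(* [K] lacks [N l - #|bulk l k|] terms of the periodic Hamiltonian, each of norm at most [c]. *)
have Kge v : lam * l2norm v ^+ 2 <= complex.Re (inner v (K *m v)).
  have := ground_energy_density_le v fl.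
  rewrite tau_sumE (bigID (mem (bulk l k))) /= -/K mulmxDl innerDr ReD.
  rewrite /lam mulrBl lerBlDr => h; apply: le_trans h _; rewrite lerD2l.
  apply: le_trans (Re_le_normc _) _.
  suff : opbound ((N l - #|bulk l k|%:R) * c)
     (\sum_(x | x \notin bulk l k) embed (@site d l S x) ho).
    exact: opbound_inner.
  have -> : (N l - #|bulk l k|%:R) * c = \sum_(x | x \notin bulk l k) c.
    rewrite sumr_const -[RHS]mulr_natl; congr (_ * c).
    apply: (canLR (addrK _)); rewrite -natrD addnC /N; congr (_%:R).
    by rewrite -(cardC (mem (bulk l k))); congr (_ + _)%N.
  apply: opbound_sum => x _; apply: embed_opbound => //; exact: site_inj.
have psdK : psd (K - lam%:C%:M).
  move=> v; rewrite mulmxBl innerDr innerNr mul_scalar_mx innerZr innervv.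
  rewrite -rmorphM ReD ReN subr_ge0; exact: Kge.
have hK' : K - lam%:C%:M \is hermsymmx.
  by apply: hermI; rewrite adjmxB adjmx_scalar_real hermP.
(* As the box takes all positions [a], each fixed term [x] visits every site of the large torus once
   and so contributes one full Hamiltonian. *)
have sumK : \sum_a embed (box a) K = #|bulk l k|%:R *: tau_sum M ho.
  rewrite /K; under eq_bigr do rewrite linear_sum /=.
  rewrite exchange_big /= scaler_nat -sumr_const; apply: eq_bigr => x xk.
  pose w : torus d M := [ffun i => inord (x i)].
  rewrite tau_sumE [RHS](reindex_inj (addIr w)) /=.
  apply: eq_bigr => a _; rewrite embed_comp; last exact: box_inj.
  by rewrite (box_site lM a hk xk).
have main v : l2norm v = 1 ->
    N M * lam <= #|bulk l k|%:R * complex.Re (inner v (tau_sum M ho *m v)).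
  move=> v1.
  have -> : #|bulk l k|%:R * complex.Re (inner v (tau_sum M ho *m v))
      = complex.Re (inner v ((\sum_a embed (box a) K) *m v)).
    rewrite sumK -scalemxAl innerZr -(rmorph_nat (real_complex R)).
    by rewrite ReM_real.
  rewrite mulmx_suml inner_sumr Re_sum /N mulr_natl -sumr_const.
  apply: ler_sum => a _.
  have := embed_psd (box_inj lM (a := a)) hK' psdK v.
  rewrite linearB /= embed_scalar; last exact: box_inj.
  rewrite mulmxBl innerDr innerNr mul_scalar_mx innerZr innervv v1 expr1n mulr1.
  by rewrite ReD ReN subr_ge0.
have [I0|I0] := eqVneq #|bulk l k| 0%N.
  have [v v1] := unit_vector (torus d M) q0.
  by have := main v v1; rewrite I0 !mul0r pmulr_rle0.
have Ip : 0 < #|bulk l k|%:R :> R by rewrite ltr0n lt0n.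
rewrite mulrC -ler_pdivrMr //; apply: le_ground_energy_density => v v1.
rewrite ler_pdivrMr // -mulrA ler_pdivlMl // [_ * #|_|%:R]mulrC.
exact: main.
Qed.

(** The limit is the supremum of [g l - C / l.+1]: every later [g M] is at least this value, and
    [g M] exceeds the supremum by at most [C / M.+1]. *)
Lemma almost_monotone_cvg (g : nat -> R) (l0 : nat) (C b : R) :
  (forall l, (l0 <= l)%N -> `|g l| <= b) ->
  (forall l M, (l0 <= l)%N -> (l <= M)%N -> g l <= g M + C / l.+1%:R) ->
  exists x : R, g l @[l --> \oo] --> x.
Proof.
move=> gb gm; pose A := [set g l - C / l.+1%:R | l in [set l | (l0 <= l)%N]].
have Cl : C / l.+1%:R @[l --> \oo] --> (0 : R).
  rewrite -(mulr0 C); apply: cvgM; first exact: cvg_cst.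
  exact: cvg_harmonic.
have supA : has_sup A.
  split; first by exists (g l0 - C / l0.+1%:R); exists l0 => /=.
  exists b => _ [l /= l0l <-]; rewrite lerBlDr.
  apply: (le_trans (gm l l l0l (leqnn l))); rewrite lerD2r.
  exact: le_trans (ler_norm _) (gb l l0l).
exists (sup A); apply/cvgrPdist_le => eps eps0.
have [_ [l /= l0l <-] lsup] := sup_adherent eps0 supA.
have Ceps : \forall m \near \oo, C / m.+1%:R <= eps.
  move/cvgrPdist_le : Cl => /(_ eps eps0); apply: filterS => m.
  rewrite sub0r normrN; exact: le_trans (ler_norm _).
near=> m.
have lm : (l <= m)%N by near: m; exact: nbhs_infty_ge.
have l0m : (l0 <= m)%N := leq_trans l0l lm.
have h1 : g m - C / m.+1%:R <= sup A by apply: sup_upper_bound => //; exists m.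
have h2 := gm l m l0l lm.
have h3 : C / m.+1%:R <= eps by near: m.
move: h1 h2 h3 lsup; move: (C / _) (C / _) (sup A) (g m) (g l) => x y z t w *.
by rewrite ler_norml; apply/andP; split; lra.
Unshelve. all: by end_near.
Qed.

Lemma ground_energy_density_cvg : exists x : R, e l @[l --> \oo] --> x.
Proof.
have [l1 fits1] := eventually_fits S; have [k hk] := fset_bound S.
(* [l1] makes [S] fit and [2k] validates the bulk estimate. The missing fraction of terms costs
   [c - e M] per site, at most [2c]. *)
apply: (@almost_monotone_cvg _ (maxn l1 k.*2) (2 * c * (d * k.*2)%:R) c).
  move=> l; rewrite geq_max => /andP[l1l _]; rewrite ler_norml.
  exact/ground_energy_density_bounded/fits1.
move=> l M; rewrite geq_max => /andP[l1l kl] lM.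
have fl := fits1 _ l1l; have fM := fits1 _ (leq_trans l1l lM).
have := anderson_bound lM fl fM hk.
have /andP[+ _] := ground_energy_density_bounded fM.
have := bulk_fraction kl; rewrite -/(N l).
set I : R := #|_|%:R => hI eM h.
pose rho := I / N l.
have {}h : e l - (1 - rho) * c <= rho * e M.
  have NI : N l * rho = I by rewrite mulrC divfK ?lt0r_neq0.
  rewrite -(ler_pM2l (N0 l)) mulrBr [N l * (_ * c)]mulrA mulrBr mulr1.
  by rewrite [N l * (rho * _)]mulrA NI.
have rho0 : rho <= 1.
  by rewrite ler_pdivrMr // mul1r ler_nat max_card.
have : (1 - rho) * (2 * c) <= (d * k.*2)%:R / l.+1%:R * (2 * c).
  by rewrite ler_wpM2r // mulr_ge0.
have : 0 <= (1 - rho) * (e M + c).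
  by rewrite mulr_ge0 ?subr_ge0 // -lerBlDr sub0r.
have -> : 2 * c * (d * k.*2)%:R / l.+1%:R = (d * k.*2)%:R / l.+1%:R * (2 * c).
  by rewrite -mulrA mulrC.
move: h; move: (_ / _ * (2 * c)) => y; move: (e l) (e M) => x z; nra.
Qed.

End ThermodynamicLimit.

(** * Limits along subsequences *)

Section Subsequence.
Variable R : realType.

(** Radii in [R[i]^o] are positive elements of [R[i]], and these are real; real radii therefore
    suffice. *)
Lemma cvgC_normc (u : nat -> R[i]) (l : R[i]) :
  (forall e : R, 0 < e -> \forall n \near \oo, Normc.normc (l - u n) < e) <->
  (u n : R[i]^o) @[n --> \oo] --> (l : R[i]^o).
Proof.
split=> [h|/cvgrPdist_lt h e e0].
  apply/cvgrPdist_lt => e; rewrite ltcE /= => /andP[/eqP im re].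
  apply: filterS (h _ re) => n hn; rewrite (normcE (l - u n)).
  by rewrite ltcE /= im eqxx.
have := h e%:C; rewrite ltcR => /(_ e0); apply: filterS => n.
by rewrite (normcE (l - u n)) ltcR.
Qed.

(* The limits are taken along an ultrafilter finer than the cofinite one, which
   converges in all coordinates at once; the subsequence then follows it. *)
Lemma countable_subsequence (T : countType) (f : nat -> T -> R) (b : T -> R) :
  (forall t, \forall n \near \oo, `|f n t| <= b t) ->
  exists (phi : nat -> nat) (g : T -> R), {homo phi : m n / (m < n)%N} /\
    forall t, f (phi n) t @[n --> \oo] --> g t.
Proof.
move=> fb.
have [U [UU Uoo]] := ultraFilterLemma eventually_filter.
have PU : ProperFilter U by case: UU.
have cl t : exists x : R, f n t @[n --> U] --> x.
  have Ub : (f n t @[n --> U]) `[- b t, b t]%classic.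
    apply: filterS (Uoo _ (fb t)) => n fn.
    by rewrite /= in_itv /= -ler_norml; exact: fn.
  have [x [_ xc]] := @segment_compact R _ _ _ _ Ub.
  (* Along an ultrafilter a cluster point is a limit: otherwise the preimage of the complement of
     [B] would belong to [U], and that complement would meet [B]. *)
  exists x => B xB.
  have [//|UB] := in_ultra_setVsetC ((fun n => f n t) @^-1` B) UU.
  by have [y []] := xc (~` B) B UB xB.
pose g t := sval (cid (cl t)).
have gc t : f n t @[n --> U] --> g t by rewrite /g; case: cid.
(* At stage [m] only the coordinates coded below [m] are controlled, finitely many, so the good
   indices belong to [U]; every coordinate is controlled from some stage on. *)
pose near m n := forall t, (choice.pickle t < m)%N ->
  `|g t - f n t| < m.+1%:R^-1.
have nearU m : U (near m).
  suff h k : U [set n | forall t, (choice.pickle t < k)%N ->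
                 `|g t - f n t| < m.+1%:R^-1].
    exact: h.
  elim: k => [|k ih]; first by apply: filterS filterT.
  case ek : (@choice.unpickle T k) => [t|]; last first.
    apply: filterS ih => n h t; rewrite ltnS leq_eqVlt => /orP[/eqP tk|].
      by move: ek; rewrite -tk choice.pickleK.
    exact: h.
  have Ut : U [set n | `|g t - f n t| < m.+1%:R^-1].
    by move/cvgrPdist_lt : (gc t); apply; rewrite invr_gt0.
  apply: filterS (filterI ih Ut) => n [h ht] t'; rewrite ltnS leq_eqVlt.
  move=> /orP[/eqP tk|]; last exact: h.
  by move: ek; rewrite -tk choice.pickleK => -[->].
have ex m p : exists n, (p < n)%N /\ near m n.
  have Up : U [set n | (p < n)%N] by apply: Uoo; exists p.+1.
  by have [n [pn nm]] := filter_ex (filterI Up (nearU m)); exists n.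
pose phi := fix phi m := if m is m'.+1 then sval (cid (ex m (phi m')))
                         else sval (cid (ex 0%N 0%N)).
have phiS m : (phi m < phi m.+1)%N by rewrite /=; case: cid => ? [].
have phin m : near m (phi m) by case: m => [|m] /=; case: cid => ? [].
exists phi, g; split; first exact: (homo_ltn ltn_trans phiS).
move=> t; apply/cvgrPdist_lt => e e0.
near=> n.
apply: (@lt_trans _ _ n.+1%:R^-1).
  by apply: phin; near: n; exact: nbhs_infty_gt.
by near: n; exact: near_infty_natSinv_lt (PosNum e0).
Unshelve. all: by end_near.
Qed.

(** Equality is required only eventually because identities between local operators hold on the
    torus once the supports fit. *)
Lemma cvgC_near_unique (u v : nat -> R[i]) (l l' : R[i]) :
  (\forall n \near \oo, u n = v n) ->
  (u n : R[i]^o) @[n --> \oo] --> (l : R[i]^o) ->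
  (v n : R[i]^o) @[n --> \oo] --> (l' : R[i]^o) -> l = l'.
Proof.
move=> uv /cvgC_normc ul /cvgC_normc vl; apply/eqP; rewrite -subr_eq0.
apply/eqP/Normc.eq0_normc/le_anti; rewrite normc_ge0 andbT.
apply/ler_addgt0Pr => e e0; rewrite add0r.
have e2 : 0 < e / 2 by rewrite divr_gt0.
have [n [[uvn h1] h2]] := filter_ex (filterI (filterI uv (ul _ e2)) (vl _ e2)).
have -> : l - l' = (l - u n) + - (l' - v n) by rewrite uvn; ring.
apply: le_trans (normcD _ _) _; rewrite normcN [e]splitr.
exact/ltW/ltrD.
Qed.

Lemma cvgC_ReIm (u : nat -> R[i]) (x y : R) :
  complex.Re (u n) @[n --> \oo] --> x -> complex.Im (u n) @[n --> \oo] --> y ->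
  (u n : R[i]^o) @[n --> \oo] --> ((x +i* y)%C : R[i]^o).
Proof.
move=> ux uy; apply/cvgC_normc => e e0.
have e2 : 0 < e / 2 by rewrite divr_gt0.
move/cvgrPdist_lt : ux => /(_ _ e2) ux; move/cvgrPdist_lt : uy => /(_ _ e2) uy.
apply: filterS (filterI ux uy) => n [].
case: (u n) => p r /= h1 h2; rewrite [e]splitr; apply: le_lt_trans (ltrD h1 h2).
rewrite -[leRHS]ger0_norm ?addr_ge0 // -sqrtr_sqr ler_wsqrtr //.
rewrite -(real_normK (num_real (x - p))) -(real_normK (num_real (y - r))).
move: (normr_ge0 (x - p)) (normr_ge0 (y - r)).
by move: `|x - p| `|y - r| => *; nra.
Qed.

Lemma cvgC_normc_le (u : nat -> R[i]) (l : R[i]) (C : R) (v : nat -> R) :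
  (\forall n \near \oo, Normc.normc (u n) <= C + v n) ->
  v n @[n --> \oo] --> (0 : R) ->
  (u n : R[i]^o) @[n --> \oo] --> (l : R[i]^o) -> Normc.normc l <= C.
Proof.
move=> uC v0 /cvgC_normc ul; apply/ler_addgt0Pr => e e0.
have e2 : 0 < e / 2 by rewrite divr_gt0.
move/cvgrPdist_lt : v0 => /(_ _ e2) v0.
have [n [[h1 h2] h3]] := filter_ex (filterI (filterI uC v0) (ul _ e2)).
have := normcD (l - u n) (u n); rewrite subrK => h.
apply: le_trans h _; move: h2; rewrite sub0r normrN.
move=> /(le_lt_trans (ler_norm _)).
move: h1 h3; move: (Normc.normc (u n)) (Normc.normc (l - _)) (v n) => *.
by lra.
Qed.

End Subsequence.

(** * The superposition on a finite torus *)

(** With [k N <= C2], the bound on [zeta] grows like [N] while [M ^+ 2] grows like [N ^+ 2]. All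
    terms except the one in [e] are therefore of order 1/N. *)
Lemma volume_arith (F : realFieldType) (e EG C1 C2 k N a b cB m M : F) :
  0 <= C1 -> 0 <= C2 -> 0 < EG -> 0 < m -> 1 <= N ->
  k <= C2 / N -> (m * N) ^+ 2 <= M ^+ 2 ->
  4 * (4 * e + 18 * k * b ^+ 2) / EG
    + (cB ^+ 2 + 4 * b ^+ 2 * (4 * (C1 * N) + 18 * k * (N * a) ^+ 2) / EG)
      / M ^+ 2
  <= 16 * e / EG + (72 * C2 * b ^+ 2 / EG
       + (cB ^+ 2 + 4 * b ^+ 2 * (4 * C1 + 18 * C2 * a ^+ 2) / EG) / m ^+ 2)
      / N.
Proof.
move=> C10 C20 EG0 m0 N1 hk hM.
have N0 : 0 < N by apply: lt_le_trans N1.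
have p0 : 0 < m ^+ 2 by rewrite exprn_gt0.
have u0 : 0 <= EG^-1 by rewrite invr_ge0 ltW.
rewrite !exprMn in hM *; move: (sqr_ge0 a) (sqr_ge0 b) (sqr_ge0 cB) p0 hM u0.
move: (a ^+ 2) (b ^+ 2) (cB ^+ 2) (m ^+ 2) (M ^+ 2) (EG^-1).
move=> y x w p P u y0 x0 w0 p0 hM u0.
have P0 : 0 < P by apply: lt_le_trans hM; rewrite mulr_gt0 // exprn_gt0.
have hkN : k * N <= C2 by rewrite -ler_pdivlMr.
set D := w + 4 * x * (4 * C1 + 18 * C2 * y) * u.
have D0 : 0 <= D by rewrite addr_ge0 // !(mulr_ge0, addr_ge0).
have h1 : 72 * k * x * u <= 72 * C2 * x * u / N.
  rewrite ler_pdivlMr //; have := mulr_ge0 x0 u0; nra.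
have h2 : (w + 4 * x * (4 * (C1 * N) + 18 * k * (N ^+ 2 * y)) * u) / P
    <= D / p / N.
  rewrite ler_pdivrMr //; apply: (@le_trans _ _ (D / p / N * (p * N ^+ 2))).
    have -> : D / p / N * (p * N ^+ 2) = D * N by field; rewrite !lt0r_neq0.
    have h3 : w <= w * N by rewrite ler_peMr.
    have h4 : (k * N) * (N * (x * y * u)) <= C2 * (N * (x * y * u)).
      by rewrite ler_wpM2r // !mulr_ge0 // ltW.
    rewrite /D; nra.
  by rewrite ler_wpM2l // !divr_ge0 // ltW.
have -> : 4 * (4 * e + 18 * k * x) * u = 16 * e * u + 72 * k * x * u by ring.
by rewrite [X in _ <= _ + X]mulrDl -addrA lerD2l lerD.
Qed.

Section FiniteVolume.
Variables (R : realType) (d q l : nat) (S : {fset zd d}).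
Variables (ho : op R q S) (oo : op R q [fset (0 : zd d)]%fset).
Variables (E0 E1 EG m c a : R) (Phi0 Phi1 : vec R q (torus d l)).

Let S0 : {fset zd d} := [fset (0 : zd d)]%fset.
Let N : R := #|{: torus d l}|%:R.
Let H : op R q (torus d l) := tau_sum l ho.
Let O : op R q (torus d l) := tau_sum l oo.
Let Psi : vec R q (torus d l) :=
  ((l2norm (O *m Phi0))^-1)%:C *: (O *m Phi0).
Let Xi : vec R q (torus d l) := ((Num.sqrt 2)^-1)%:C *: (Phi0 + Psi).

Hypotheses (fS : fits l S) (hho : ho \is hermsymmx) (hoo : oo \is hermsymmx).
Hypotheses (c0 : 0 <= c) (hc : opbound c ho) (a0 : 0 <= a) (ha : opbound a oo).
Hypotheses (E01 : E0 < E1) (EG0 : 0 < EG) (m0 : 0 < m).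
Hypotheses (nd0 : nondegenerate_eigenvalue H E0)
  (nd1 : nondegenerate_eigenvalue H E1).
Hypotheses (ev0 : normalized_eigenstate H E0 Phi0)
  (ev1 : normalized_eigenstate H E1 Phi1).
Hypothesis gap : forall E', is_eigenvalue H E' -> E' != E0 -> E' != E1 ->
  EG <= E' - E1.
Hypotheses (O1 : inner Phi0 (O *m Phi0) = 0)
  (O2 : ((m * N) ^+ 2)%:C <= inner Phi0 (O ^+ 2 *m Phi0))
  (O3 : inner Phi0 (O ^+ 3 *m Phi0) = 0).

(** The double commutator bound per translate, as in [opbound_double_commutator]. *)
Definition locality_constant (T : {fset zd d}) (b : R) : R :=
  4 * b ^+ 2 * c * ((#|{: S}| * #|{: T}|) *
    (#|{: T}| * #|{: T}| + #|{: S}| * #|{: T}|))%:R.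

Let C1 := locality_constant S0 a.
Let C2 := C1 / (2 * m ^+ 2).

Lemma fits_origin : fits l S0.
Proof. by move=> x y; rewrite !inE => /eqP -> /eqP ->. Qed.

Lemma tau_sum_setT (T : {fset zd d}) (A : op R q T) :
  tau_sum l A = \sum_(x in [set: torus d l]%SET) embed (@site d l T x) A.
Proof. by rewrite tau_sumE; apply: eq_bigl => x; rewrite inE. Qed.

Lemma locality_constant_ge0 T b : 0 <= locality_constant T b.
Proof.
apply: mulr_ge0; last exact: ler0n.
by apply: mulr_ge0 => //; apply: mulr_ge0 => //; exact: sqr_ge0.
Qed.

Lemma volume_gt0 : 0 < N.
Proof. by rewrite /N card_torus ltr0n expn_gt0. Qed.

Let N0 : 0 < N := volume_gt0.

Let hH : H \is hermsymmx. Proof. exact: tau_sum_herm. Qed.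
Let hO : O \is hermsymmx. Proof. exact: tau_sum_herm. Qed.

Let hdO : opbound (C1 * N) (commutator O (commutator H O)).
Proof.
have := opbound_double_commutator fS fits_origin a0 c0 ha hc
  [set: torus d l]%SET.
by rewrite cardsT -tau_sum_setT.
Qed.

Let hbO : opbound (N * a) O.
Proof. exact: opbound_tau_sum fits_origin a0 ha. Qed.

Let M := l2norm (O *m Phi0).

Lemma order_lower_bound : m * N <= M.
Proof.
have := O2; have -> : O ^+ 2 = O *m O by rewrite expr2.
rewrite -mulmxA -inner_herm // innervv lecR.
by rewrite ler_sqr ?nnegrE ?l2norm_ge0 // mulr_ge0 ?ltW.
Qed.

Let M0 : 0 < M.
Proof. by apply: lt_le_trans order_lower_bound; rewrite mulr_gt0. Qed.

Let kappa := C1 * N / (2 * M ^+ 2).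

Let kappa_le : kappa <= C2 / N.
Proof.
rewrite /kappa ler_pdivrMr ?mulr_gt0 ?exprn_gt0 // /C2.
have -> : C1 / (2 * m ^+ 2) / N * (2 * M ^+ 2) = (C1 * N) * (M / (m * N)) ^+ 2.
  by field; rewrite !lt0r_neq0.
rewrite -[leLHS]mulr1; apply: ler_wpM2l.
  exact: mulr_ge0 (locality_constant_ge0 _ _) (ltW N0).
by rewrite exprn_ege1 // ler_pdivlMr ?mulr_gt0 // mul1r order_lower_bound.
Qed.

Lemma l2norm_state : l2norm Xi = 1.
Proof. exact: (l2norm_Xi ev0 O1 erefl M0 erefl erefl erefl). Qed.

(** Phi0 is translated into a phase times itself, and [O] passes the same phase to Psi; the common
    phase makes Xi invariant up to a phase, which cancels in expectations. *)
Lemma state_translation x (A : op R q (torus d l)) :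
  inner Xi (tau x A *m Xi) = inner Xi (A *m Xi).
Proof.
have [HPhi0 nPhi0] := ev0.
have [b hb] : exists b, translate x Phi0 = b *: Phi0.
  apply: (nondegenerate_colinear nd0 _ HPhi0 (l2norm1_neq0 nPhi0)).
  have tH : tau x H = H := tau_tau_sum x ho.
  by rewrite -{1}tH tau_translate HPhi0 linearZ.
have tO : translate x (O *m Phi0) = b *: (O *m Phi0).
  by rewrite -tau_translate tau_tau_sum hb -scalemxAr.
have tXi : translate x Xi = b *: Xi.
  rewrite /Xi linearZ linearD /= /Psi linearZ /= tO hb.
  by apply/colP => k; rewrite !mxE; ring.
have b1 : b^* * b = 1.
  have := inner_translate x Phi0 Phi0; rewrite hb innerZl innerZr.
  by rewrite inner_normalized // mulr1.
rewrite -[RHS](inner_translate x) -tau_translate tXi.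
by rewrite [in RHS]innerZl -[in RHS]scalemxAr [in RHS]innerZr mulrA b1 mul1r.
Qed.

Lemma state_energy : C2 / N <= EG / 4 ->
  E0 <= complex.Re (inner Xi (H *m Xi)) <= E0 + EG / 4.
Proof.
move=> small.
have /andP[-> h] := energy_Xi hH hO E01 EG0 nd0 ev0 gap O1 hdO erefl M0 erefl
  (erefl kappa) erefl erefl.
by rewrite (le_trans h) // lerD2l (le_trans kappa_le).
Qed.

(** [X] is the region on the torus and [B] the same sum on its neighbourhood [U]. The norm [b] and
    the size of [U] enter only the coefficient of [1 / N]. *)
Lemma state_variance (T : {fset zd d}) (X : {set torus d l}) (A : op R q T)
    (U : {fset zd d}) (B : op R q U) (a' b : R) :
  C2 / N <= EG / 4 -> fits l T -> fits l U -> 0 <= a' -> opbound a' A ->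
  B \is hermsymmx -> 0 <= b -> opbound b B ->
  on_torus l B = \sum_(x in X) embed (@site d l T x) A ->
  l2norm (on_torus l B *m Xi - inner Xi (on_torus l B *m Xi) *: Xi) ^+ 2
   <= 16 * (locality_constant T a' * #|X|%:R) / EG
     + (72 * C2 * b ^+ 2 / EG
        + ((2 * (a * b) * (#|{: S0}| * #|{: U}|)%:R) ^+ 2
           + 4 * b ^+ 2 * (4 * C1 + 18 * C2 * a ^+ 2) / EG) / m ^+ 2) / N.
Proof.
move=> small fT fU a'0 ha' hB b0 hb BE.
have hB' : on_torus l B \is hermsymmx by exact: embed_herm.
have hb' : opbound b (on_torus l B).
  by rewrite on_torus_site; apply: embed_opbound => //; exact: site_inj.
have he : opbound (locality_constant T a' * #|X|%:R)
    (commutator (on_torus l B) (commutator H (on_torus l B))).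
  by rewrite BE; exact: opbound_double_commutator.
have hcB : opbound (2 * (a * b) * (#|{: S0}| * #|{: U}|)%:R)
    (commutator O (on_torus l B)).
  rewrite on_torus_site.
  exact: opbound_commutator_tau_sum fits_origin _ _ _ _ _.
have k4 := le_trans kappa_le small.
have O3' : inner Phi0 (O *m (O *m (O *m Phi0))) = 0.
  have O3E : O ^+ 3 = O *m (O *m O) by rewrite !exprS expr0 mulr1.
  by rewrite -O3 O3E -!mulmxA.
have bO0 : 0 <= N * a := mulr_ge0 (ltW N0) a0.
have := variance_bound hH hO E01 EG0 nd0 nd1 ev0 ev1 gap O1 O3' bO0 hbO hdO
  erefl M0 erefl (erefl kappa) erefl erefl k4 hB' b0 hb' he hcB
  erefl erefl erefl.
move=> h; apply: le_trans h _.
have C10 : 0 <= C1 := locality_constant_ge0 _ _.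
have C20 : 0 <= C2 by rewrite divr_ge0 // mulr_ge0 // sqr_ge0.
have N1 : 1 <= N by rewrite /N ler1n card_torus expn_gt0.
apply: volume_arith kappa_le _ => //.
by rewrite ler_sqr ?nnegrE ?order_lower_bound ?l2norm_ge0 // mulr_ge0 // ltW.
Qed.

End FiniteVolume.

(** * The infinite volume state *)

Section ComplexLimits.
Variable R : realType.
Implicit Types (u v : nat -> R[i]) (k l : R[i]).

Lemma Re_norm_le k : `|complex.Re k| <= Normc.normc k.
Proof.
by case: k => x y /=; rewrite -sqrtr_sqr ler_wsqrtr // lerDl sqr_ge0.
Qed.

Lemma Im_norm_le k : `|complex.Im k| <= Normc.normc k.
Proof.
by case: k => x y /=; rewrite -sqrtr_sqr ler_wsqrtr // lerDr sqr_ge0.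
Qed.

Lemma cvgC_dist u l : (u n : R[i]^o) @[n --> \oo] --> (l : R[i]^o) ->
  Normc.normc (u n - l) @[n --> \oo] --> (0 : R).
Proof.
move=> /cvgC_normc ul; apply/cvgrPdist_lt => e e0.
apply: filterS (ul e e0) => n.
by rewrite sub0r normrN ger0_norm ?normc_ge0 // -normcN opprB.
Qed.

Lemma cvgCD u v k l : (u n : R[i]^o) @[n --> \oo] --> (k : R[i]^o) ->
  (v n : R[i]^o) @[n --> \oo] --> (l : R[i]^o) ->
  (u n + v n : R[i]^o) @[n --> \oo] --> (k + l : R[i]^o).
Proof.
move=> /cvgC_normc uk /cvgC_normc vl; apply/cvgC_normc => e e0.
have e2 : 0 < e / 2 by rewrite divr_gt0.
apply: filterS (filterI (uk _ e2) (vl _ e2)) => n [h1 h2].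
rewrite opprD addrACA [e]splitr; apply: le_lt_trans (normcD _ _) _.
exact: ltrD.
Qed.

Lemma cvgCZ (a : R[i]) u l : (u n : R[i]^o) @[n --> \oo] --> (l : R[i]^o) ->
  (a * u n : R[i]^o) @[n --> \oo] --> (a * l : R[i]^o).
Proof.
move=> /cvgC_normc ul; apply/cvgC_normc => e e0.
have a1 : 0 < Normc.normc a + 1 by rewrite ltr_wpDl ?normc_ge0.
have e1 : 0 < e / (Normc.normc a + 1) by rewrite divr_gt0.
apply: filterS (ul _ e1) => n h; rewrite -mulrBr Normc.normcM.
apply: (@le_lt_trans _ _ ((Normc.normc a + 1) * Normc.normc (l - u n))).
  by rewrite ler_wpM2r ?normc_ge0 // lerDl.
by rewrite mulrC -ltr_pdivlMr.
Qed.

Lemma cvgC_sum (I : Type) (s : seq I) (P : pred I) (f : I -> nat -> R[i])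
    (l : I -> R[i]) :
  (forall i, (f i n : R[i]^o) @[n --> \oo] --> (l i : R[i]^o)) ->
  (\sum_(i <- s | P i) f i n : R[i]^o) @[n --> \oo]
    --> (\sum_(i <- s | P i) l i : R[i]^o).
Proof.
move=> h; elim: s => [|i s ih].
  by under eq_fun do rewrite big_nil; rewrite big_nil; exact: cvg_cst.
have -> : (fun n => \sum_(j <- i :: s | P j) f j n) =
    (fun n => if P i then f i n + \sum_(j <- s | P j) f j n
              else \sum_(j <- s | P j) f j n).
  by apply/funext => n; rewrite big_cons.
by rewrite big_cons; case: (P i); [exact: cvgCD (h i) ih|exact: ih].
Qed.

End ComplexLimits.

(** Ergodicity centres at the limiting mean, the finite volume bound at the finite mean. The shift
    is a plain square, since [w] may be complex. *)
Lemma centered_square (R : realType) n (X : 'M[R[i]]_n) (v : 'cV[R[i]]_n) w :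
  X \is hermsymmx -> l2norm v = 1 ->
  inner v ((X - w%:M) *m (X - w%:M) *m v)
    = (l2norm (X *m v - inner v (X *m v) *: v) ^+ 2)%:C
      + (inner v (X *m v) - w) ^+ 2.
Proof.
move=> hX v1; set y := inner v (X *m v).
have yJ : (y^*)%R = y by rewrite /y -innerJ inner_herm.
have yJ' : inner (X *m v) v = y by rewrite inner_herm.
rewrite -innervv -mulmxA !mulmxBl !mulmxBr !mul_scalar_mx -scalemxAr.
rewrite !(innerDl, innerDr, innerNl, innerNr, innerZl, innerZr).
rewrite (inner_normalized v1) yJ' -/y yJ -(inner_herm v _ hX).
by ring.
Qed.

(** * Local operators and region sums read on the torus *)

Section RegionSums.
Variables (R : realType) (d q : nat).
Implicit Types (Om T U : {fset zd d}).

Lemma fits_inj l T : fits l T -> injective (fun y : T => to_torus l (fsval y)).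
Proof. by move=> fT s t /fT h; apply: val_inj; apply: h; exact: fsvalP. Qed.

Lemma on_torus_incl l T U (TU : (T `<=` U)%fset) (A : op R q T) : fits l U ->
  on_torus l (embed (fincl TU) A) = on_torus l A.
Proof. by move=> fU; rewrite /on_torus embed_comp //; exact: fits_inj. Qed.

Lemma on_torus_tau_loc l (x : zd d) T (A : op R q T) :
  fits l (Defs.shift x T) ->
  on_torus l (tau_loc x A) = embed (@site d l T (to_torus l x)) A.
Proof.
move=> fT; rewrite /on_torus /tau_loc embed_comp; last exact: fits_inj.
by congr embed; apply/funext => y /=; rewrite /site to_torusD.
Qed.

Lemma on_torus_region_sum l Om T (A : op R q T) :
  fits l Om -> fits l (region Om T) ->
  on_torus l (region_sum Om A) =
    \sum_(x in ((fun y : Om => to_torus l (fsval y)) @: predT)%SET)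
       embed (@site d l T x) A.
Proof.
move=> fO fR; rewrite big_imset /=; last by move=> s t _ _; exact: fits_inj.
rewrite {1}/on_torus /region_sum linear_sum /=; apply: eq_bigr => x _.
rewrite -/(on_torus l _) on_torus_incl // on_torus_tau_loc //.
exact: fits_sub (shift_sub_region T x) fR.
Qed.

Lemma region_sum_herm Om T (A : op R q T) :
  A \is hermsymmx -> region_sum Om A \is hermsymmx.
Proof.
move=> hA; apply: hermI; rewrite /region_sum adjmx_sum; apply: eq_bigr => x _.
by apply: hermP; do 2!apply: embed_herm.
Qed.

(** One side suffices for growth uniform in the position [a]; with [d = 0] the cube would have a
    single site. *)
Lemma card_cube (a : zd d) m : (0 < d)%N -> (m.+1 <= #|{: cube a m}|)%N.
Proof.
move=> d0.
pose f (t : torus d m) : zd d := a + [ffun i => (t i : nat)%:Z].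
pose g (t : torus d m) : cube a m :=
  [` in_imfset imfset_key f (finset.in_setT t)]%fset.
have ginj : injective g.
  move=> s t /(congr1 (@fsval _ _)) /= /addrI /ffunP h; apply/ffunP => i.
  by have := h i; rewrite !ffunE => -[]; exact: ord_inj.
apply: leq_trans (leq_card g ginj); rewrite card_torus.
by rewrite -[X in (X <= _)%N]expn1 leq_pexp2l.
Qed.

Lemma on_torusP l T (k : R[i]) (A B : op R q T) :
  on_torus l (k *: A + B) = k *: on_torus l A + on_torus l B.
Proof. exact: linearP. Qed.

Lemma on_torus_sum_delta l T (A : op R q T) :
  on_torus l A = \sum_i \sum_j A i j *: on_torus l (delta_mx i j).
Proof.
rewrite {1}[A]matrix_sum_delta /on_torus linear_sum; apply: eq_bigr => i _.
by rewrite linear_sum; apply: eq_bigr => j _; rewrite linearZ.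
Qed.

Lemma opbound_on_torus l T (A : op R q T) (b : R) : fits l T -> 0 <= b ->
  opbound b A -> opbound b (on_torus l A).
Proof.
move=> fT b0 hb; rewrite on_torus_site.
by apply: embed_opbound => //; exact: site_inj.
Qed.

End RegionSums.

Section InfiniteVolume.
Variables (R : realType) (d q : nat) (S : {fset zd d}).
Variables (ho : op R q S) (oo : op R q [fset (0 : zd d)]%fset).
Variables (EG m c a : R) (L : nat -> nat) (E0 E1 : nat -> R).
Variables (Phi0 Phi1 : forall n, vec R q (torus d (L n))).

Let N n : R := #|{: torus d (L n)}|%:R.
Let H n : op R q (torus d (L n)) := tau_sum (L n) ho.
Let O n : op R q (torus d (L n)) := tau_sum (L n) oo.
Let Psi n : vec R q (torus d (L n)) :=
  ((l2norm (O n *m Phi0 n))^-1)%:C *: (O n *m Phi0 n).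
Let Xi n : vec R q (torus d (L n)) :=
  ((Num.sqrt 2)^-1)%:C *: (Phi0 n + Psi n).

Hypotheses (d0 : (0 < d)%N) (Loo : L n @[n --> \oo] --> \oo).
Hypothesis fS : forall n, fits (L n) S.
Hypotheses (hho : ho \is hermsymmx) (hoo : oo \is hermsymmx).
Hypotheses (c0 : 0 <= c) (hc : opbound c ho) (a0 : 0 <= a) (ha : opbound a oo).
Hypotheses (EG0 : 0 < EG) (m0 : 0 < m).
Hypothesis E01 : forall n, E0 n < E1 n.
Hypothesis nd0 : forall n, nondegenerate_eigenvalue (H n) (E0 n).
Hypothesis nd1 : forall n, nondegenerate_eigenvalue (H n) (E1 n).
Hypothesis ev0 : forall n, normalized_eigenstate (H n) (E0 n) (Phi0 n).
Hypothesis ev1 : forall n, normalized_eigenstate (H n) (E1 n) (Phi1 n).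
Hypothesis gap : forall n E', is_eigenvalue (H n) E' -> E' != E0 n ->
  E' != E1 n -> EG <= E' - E1 n.
Hypothesis O1 : forall n, inner (Phi0 n) (O n *m Phi0 n) = 0.
Hypothesis O2 : forall n,
  ((m * N n) ^+ 2)%:C <= inner (Phi0 n) (O n ^+ 2 *m Phi0 n).
Hypothesis O3 : forall n, inner (Phi0 n) (O n ^+ 3 *m Phi0 n) = 0.

Lemma normalized_Xi n : l2norm (Xi n) = 1.
Proof.
have h := l2norm_state hoo m0 (ev0 n) (O1 n) (O2 n).
exact: h.
Qed.

Lemma near_fits (T : {fset zd d}) : \forall n \near \oo, fits (L n) T.
Proof.
have [l0 hl0] := eventually_fits T.
have h : \forall n \near \oo, (l0 <= L n)%N by exact: Loo (nbhs_infty_ge l0).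
by apply: filterS h => n; exact: hl0.
Qed.

Lemma inv_volume_cvg (D : R) : D / N n @[n --> \oo] --> (0 : R).
Proof.
rewrite -[X in _ --> X](mulr0 D); apply: cvgM; first exact: cvg_cst.
apply/cvgrPdist_lt => e e0.
have near_e : \forall n \near \oo, (L n).+1%:R^-1 < e.
  exact: Loo (near_infty_natSinv_lt (PosNum e0)).
apply: filterS near_e => n /= h.
rewrite sub0r normrN ger0_norm ?invr_ge0 ?ler0n //; apply: le_lt_trans h.
rewrite lef_pV2 ?posrE ?ltr0n //; last by rewrite card_torus expn_gt0.
by rewrite ler_nat card_torus -[X in (X <= _)%N]expn1 leq_pexp2l.
Qed.

Lemma near_small (D e : R) : 0 < e -> \forall n \near \oo, D / N n <= e.
Proof.
move=> e0; have /cvgrPdist_le/(_ e e0) := inv_volume_cvg D.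
by apply: filterS => n; rewrite sub0r normrN; exact/le_trans/ler_norm.
Qed.

Lemma expectation_le n (T : {fset zd d}) (A : op R q T) (b : R) :
  fits (L n) T -> 0 <= b ->
  opbound b A -> Normc.normc (inner (Xi n) (on_torus (L n) A *m Xi n)) <= b.
Proof.
move=> fT b0 hb; have := opbound_inner (Xi n) (opbound_on_torus fT b0 hb).
by rewrite normalized_Xi expr1n mulr1.
Qed.

(** Matrix units over all finite sets of sites are countably many and span the local operators.
    Their real and imaginary parts converge along one subsequence, and linearity gives the rest. *)
Lemma limit_exists : exists (phi : nat -> nat) (omega : functional R d q),
  {homo phi : m n / (m < n)%N} /\ vector_limit (fun n => Xi (phi n)) omega.
Proof.
pose T := {U : {fset zd d} &
  ('I_#|{: config q U}| * 'I_#|{: config q U}| * bool)%type}.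
pose E (U : {fset zd d}) i j : op R q U := delta_mx i j.
pose ev n U i j := inner (Xi n) (on_torus (L n) (E U i j) *m Xi n).
pose f n (t : T) : R := let: existT U (i, j, b) := t in
  if b then complex.Re (ev n U i j) else complex.Im (ev n U i j).
pose bd (t : T) : R := let: existT U (i, j, _) := t in
  sval (cid2 (opbound_ex (E U i j))).
have [|phi [g [phi_incr gc]]] := @countable_subsequence _ T f bd.
  move=> [U [[i j] b]]; apply: filterS (near_fits U) => n fU /=.
  case: cid2 => x /= x0 hx; have := expectation_le fU x0 hx.
  by case: b; apply: le_trans; [exact: Re_norm_le|exact: Im_norm_le].
pose lim U i j : R[i] := (g (existT _ U (i, j, true))
                          +i* g (existT _ U (i, j, false)))%C.
exists phi, (fun U A => \sum_i \sum_j A i j * lim U i j); split=> // U A.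
have evE n : inner (Xi n) (on_torus (L n) A *m Xi n)
    = \sum_i \sum_j A i j * ev n U i j.
  rewrite on_torus_sum_delta mulmx_suml inner_sumr; apply: eq_bigr => i _.
  rewrite mulmx_suml inner_sumr; apply: eq_bigr => j _.
  by rewrite -scalemxAl innerZr.
under eq_fun do rewrite evE.
apply: cvgC_sum => i; apply: cvgC_sum => j; apply: cvgCZ; apply: cvgC_ReIm.
  exact: gc (existT _ U (i, j, true)).
exact: gc (existT _ U (i, j, false)).
Qed.

Variable omega : functional R d q.
Hypothesis lim_omega : vector_limit Xi omega.

Lemma limit_expectation (T : {fset zd d}) (A : op R q T) :
  (inner (Xi n) (on_torus (L n) A *m Xi n) : R[i]^o) @[n --> \oo]
    --> (omega A : R[i]^o).
Proof. exact: lim_omega. Qed.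

Lemma limit_local_functional : local_functional omega.
Proof.
split=> [U k A B|U T UT A].
  have h : \forall n \near \oo,
      inner (Xi n) (on_torus (L n) (k *: A + B) *m Xi n)
        = k * inner (Xi n) (on_torus (L n) A *m Xi n)
          + inner (Xi n) (on_torus (L n) B *m Xi n).
    by apply: nearW => n; rewrite on_torusP mulmxDl innerDr -scalemxAl innerZr.
  have h1 := cvgCZ (a := k) (@limit_expectation _ A).
  have h2 := cvgCD h1 (@limit_expectation _ B).
  have h3 := cvgC_near_unique h (@limit_expectation _ (k *: A + B)) h2.
  exact: h3.
apply: (cvgC_near_unique _ (@limit_expectation _ _) (@limit_expectation _ A)).
by apply: filterS (near_fits T) => n fT; rewrite on_torus_incl.
Qed.

Lemma limit_infinite_volume_state : infinite_volume_state omega.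
Proof.
split; first exact: limit_local_functional.
exists L, (fun n A => inner (Xi n) (A *m Xi n)); split=> // n; split.
- by move=> k A B; rewrite mulmxDl innerDr -scalemxAl innerZr.
- by move=> A; rewrite -mulmxA -inner_adjl inner_ge0.
- by rewrite mul1mx inner_normalized // normalized_Xi.
Qed.

Lemma limit_tau_loc x (T : {fset zd d}) (A : op R q T) :
  \forall n \near \oo,
    inner (Xi n) (on_torus (L n) (tau_loc x A) *m Xi n)
      = inner (Xi n) (on_torus (L n) A *m Xi n).
Proof.
apply: filterS (near_fits (Defs.shift x T)) => n fT.
rewrite on_torus_tau_loc // -tau_on_torus.
exact: (state_translation _ (nd0 n) (ev0 n)).
Qed.

Lemma limit_translation_invariant : translation_invariant omega.
Proof.
move=> x T A; exact: cvgC_near_unique (limit_tau_loc x A)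
  (@limit_expectation _ _) (@limit_expectation _ _).
Qed.

(** By translation invariance of Xi all terms of [H] have equal expectation, so one term is the
    energy per site. *)
Lemma energy_density n : inner (Xi n) (on_torus (L n) ho *m Xi n)
  = ((N n)^-1 * complex.Re (inner (Xi n) (H n *m Xi n)))%:C.
Proof.
have Npos : 0 < N n := volume_gt0 _ _ _.
have -> : inner (Xi n) (on_torus (L n) ho *m Xi n)
    = (N n)^-1%:C * inner (Xi n) (H n *m Xi n).
  rewrite /H /tau_sum mulmx_suml inner_sumr.
  rewrite (eq_bigr (fun=> inner (Xi n) (on_torus (L n) ho *m Xi n))); last first.
    by move=> x _; exact: (state_translation _ (nd0 n) (ev0 n)).
  rewrite sumr_const -mulr_natl mulrA -(rmorph_nat (real_complex R)) -rmorphM.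
  by rewrite mulVf ?lt0r_neq0 // mul1r.
transitivity ((N n)^-1%:C * (complex.Re (inner (Xi n) (H n *m Xi n)))%:C).
  congr (_ * _); symmetry; apply: RRe_real.
  apply/CrealP; rewrite -innerJ inner_herm //; exact: tau_sum_herm.
by rewrite -rmorphM.
Qed.

Lemma limit_ground_state : ground_state ho omega.
Proof.
(* With [q = 0] the torus has no configuration and Phi0 could not be normalized. *)
have q0 : (0 < q)%N.
  rewrite lt0n; apply/eqP => q0.
  have : Phi0 0 != 0 := l2norm1_neq0 (proj2 (ev0 0)).
  apply/negP; rewrite negbK; apply/eqP/colP => i.
  have s := enum_val i : config q (torus d (L 0)); exfalso.
  by case: (s 0) => k; rewrite q0.
have [eps0 eps0_lim] := ground_energy_density_cvg q0 hho c0 hc.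
exists eps0 => // x.
have elim : ground_energy_density (L n) ho @[n --> \oo] --> eps0.
  exact: cvg_comp Loo eps0_lim.
pose rho n := (N n)^-1 * complex.Re (inner (Xi n) (H n *m Xi n)).
have rho_lim : rho n @[n --> \oo] --> eps0.
  (* The total energy of Xi exceeds E0 by at most [EG / 4], which per site vanishes in the limit. *)
  apply: (@squeeze_cvgr _ _ _ _ (fun n => ground_energy_density (L n) ho)
    (fun n => ground_energy_density (L n) ho + EG / 4 / N n)) => //; last first.
    by rewrite -[X in _ --> X]addr0; apply: cvgD => //; exact: inv_volume_cvg.
  have EG4 : 0 < EG / 4 by rewrite divr_gt0.
  apply: filterS (near_small
    (locality_constant S c [fset 0]%fset a / (2 * m ^+ 2)) EG4) => n small.
  have Npos : 0 < N n := volume_gt0 _ _ _.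
  have /andP[h1 h2] := state_energy (@fS n) hho hoo c0 hc a0 ha (E01 n) EG0 m0
    (nd0 n) (ev0 n) (@gap n) (O1 n) (O2 n) small.
  have h3 := ground_energy_density_le c0 hc (Xi n) (@fS n).
  rewrite normalized_Xi expr1n mulr1 in h3.
  apply/andP; split; first by rewrite /rho ler_pdivlMl.
  have Ninv : 0 <= (N n)^-1 by rewrite invr_ge0 ltW.
  have key v : l2norm v = 1 ->
      (N n)^-1 * E0 n <= (N n)^-1 * complex.Re (inner v (H n *m v)).
    move=> v1; apply: ler_wpM2l Ninv _ _ _.
    have := ground_energy_le (tau_sum_herm (L n) hho) (E01 n) EG0 (@gap n) v.
    by rewrite v1 expr1n mulr1.
  have e0 := le_ground_energy_density q0 key.
  rewrite /rho; apply: (@le_trans _ _ ((N n)^-1 * (E0 n + EG / 4))).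
    exact: ler_wpM2l Ninv _ _ h2.
  by rewrite mulrDr [X in _ + X]mulrC lerD2r.
apply: (cvgC_near_unique (limit_tau_loc x ho) (@limit_expectation _ _)).
under eq_fun do rewrite energy_density.
by apply: cvgC_ReIm => //=; exact: cvg_cst.
Qed.

(** The finite volume bound has two vanishing parts, collected in [v]: the 1/N term and the squared
    distance of the finite mean from its limit. *)
Lemma limit_variance (T Om : {fset zd d}) (A : op R q T) (b : R) :
  A \is hermsymmx -> 0 <= b -> opbound b A ->
  forall B, B = region_sum Om A - (omega (region_sum Om A))%:M ->
  Normc.normc (omega (B *m B))
    <= 16 * (locality_constant S c T b * #|{: Om}|%:R) / EG.
Proof.
move=> hA b0 hb B BE; pose AOm := region_sum Om A; pose U := region Om T.
have hAOm : AOm \is hermsymmx by exact: region_sum_herm.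
have [b' b'0 hb'] := opbound_ex AOm.
pose C2 := locality_constant S c [fset 0]%fset a / (2 * m ^+ 2).
pose y n := inner (Xi n) (on_torus (L n) AOm *m Xi n).
pose D := 72 * C2 * b' ^+ 2 / EG
  + ((2 * (a * b') * (#|{: [fset (0 : zd d)]%fset}| * #|{: U}|)%:R) ^+ 2
     + 4 * b' ^+ 2 * (4 * locality_constant S c [fset 0]%fset a
                      + 18 * C2 * a ^+ 2) / EG) / m ^+ 2.
pose v n := D / N n + Normc.normc (y n - omega AOm) ^+ 2.
have v0 : v n @[n --> \oo] --> (0 : R).
  rewrite -[X in _ --> X]addr0; apply: cvgD; first exact: inv_volume_cvg.
  have h := cvgC_dist (@limit_expectation _ AOm).
  by rewrite -[X in _ --> X](mulr0 (0 : R)); apply: cvgM.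
apply: cvgC_normc_le v0 (@limit_expectation _ _).
have EG4 : 0 < EG / 4 by rewrite divr_gt0.
apply: filterS (filterI (filterI (near_fits U) (near_fits Om))
  (filterI (near_fits T) (near_small C2 EG4))) => n [[fU fO] [fT small]].
have XE : on_torus (L n) (B *m B) = (on_torus (L n) AOm - (omega AOm)%:M)
    *m (on_torus (L n) AOm - (omega AOm)%:M).
  by rewrite BE /on_torus embedM ?linearB /= ?embed_scalar //; exact: fits_inj.
rewrite XE centered_square ?normalized_Xi //; last exact: embed_herm.
rewrite -/(y n); apply: le_trans (normcD _ _) _.
rewrite normc_real ger0_norm ?sqr_ge0 // expr2 Normc.normcM -expr2 /v addrA.
rewrite lerD2r.
have := state_variance (@fS n) hho hoo c0 hc a0 ha (E01 n) EG0 m0 (nd0 n) (nd1 n)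
  (ev0 n) (ev1 n) (@gap n) (O1 n) (O2 n) (O3 n) small fT fU b0 hb hAOm b'0 hb'
  (on_torus_region_sum A fO fU).
by rewrite card_imset //; exact: fits_inj.
Qed.

(** The variance bound is linear in the number of sites, so division by its square leaves a constant
    over the size of the cube. *)
Lemma limit_ergodic : ergodic omega.
Proof.
move=> T A hA eps eps0.
have [b b0 hb] := opbound_ex A.
set C := 16 * locality_constant S c T b / EG.
have Ceps : \forall k \near \oo, C / k.+1%:R < eps.
  have Ck : C / k.+1%:R @[k --> \oo] --> (0 : R).
    rewrite -(mulr0 C); apply: cvgM; first exact: cvg_cst.
    exact: cvg_harmonic.
  move/cvgrPdist_lt : Ck => /(_ eps eps0); apply: filterS => k.
  by rewrite sub0r normrN; exact/le_lt_trans/ler_norm.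
apply: filterS Ceps => k Ck x; cbv zeta; set B := (_ - _).
have hv := limit_variance hA b0 hb (erefl B).
have cube_gt0 : 0 < #|{: cube x k}|%:R :> R.
  by rewrite ltr0n (leq_trans _ (card_cube x k d0)).
have -> : #|` cube x k|%:R = (#|{: cube x k}|%:R : R)%:C :> R[i].
  by rewrite rmorph_nat cardfE.
rewrite normrM normcE -rmorphXn -fmorphV normcE -rmorphM ltcR normc_real.
rewrite ger0_norm ?invr_ge0 ?sqr_ge0 //; apply: le_lt_trans Ck.
apply: (@le_trans _ _ (C / #|{: cube x k}|%:R)).
  rewrite ler_pdivrMl ?exprn_gt0 //; apply: le_trans hv _.
  by rewrite /C le_eqVlt; apply/orP; left; apply/eqP; field; rewrite !lt0r_neq0.
have C0 : 0 <= C.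
  by rewrite divr_ge0 ?(ltW EG0) // mulr_ge0 // locality_constant_ge0.
have hk : k.+1%:R <= #|{: cube x k}|%:R :> R by rewrite ler_nat card_cube.
by apply: ler_wpM2l => //; rewrite lef_pV2 ?posrE.
Qed.

End InfiniteVolume.

Theorem corollary2 (R : realType) (d q r : nat)
    (S : {fset zd d}) (ho : op R q S) (oo : op R q [fset (0 : zd d)]%fset)
    (h o EG mu : R)
    (L : nat -> nat) (E0 E1 : nat -> R)
    (Phi0 Phi1 : forall n, vec R q (torus d (L n))) :
  let N n : R := #|{: torus d (L n)}|%:R in
  let H n : op R q (torus d (L n)) := tau_sum (L n) ho in
  let O n : op R q (torus d (L n)) := tau_sum (L n) oo in
  let Psi n : vec R q (torus d (L n)) :=
    ((l2norm (O n *m Phi0 n))^-1)%:C *: (O n *m Phi0 n) in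
  let Xi n : vec R q (torus d (L n)) :=
    ((Num.sqrt 2)^-1)%:C *: (Phi0 n + Psi n) in
  (0 < d)%N ->
  L n @[n --> \oo] --> \oo ->
  (forall n, {in S &, injective (to_torus (L n))}) ->
  ho \is hermsymmx -> oo \is hermsymmx ->
  (#|` S| <= r)%N ->
  0 < h -> 0 < o -> 0 < EG -> 0 < mu ->
  (forall n (x : torus d (L n)), opnorm (tau x (on_torus (L n) ho)) <= h) ->
  (forall n (x : torus d (L n)), opnorm (tau x (on_torus (L n) oo)) <= o) ->
  (forall n, E0 n < E1 n) ->
  (forall n, nondegenerate_eigenvalue (H n) (E0 n)) ->
  (forall n, nondegenerate_eigenvalue (H n) (E1 n)) ->
  (forall n, normalized_eigenstate (H n) (E0 n) (Phi0 n)) ->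
  (forall n, normalized_eigenstate (H n) (E1 n) (Phi1 n)) ->
  (forall n (E' : R), is_eigenvalue (H n) E' -> E' != E0 n -> E' != E1 n ->
     EG <= E' - E1 n) ->
  (forall n, inner (Phi0 n) (O n *m Phi0 n) = 0) ->
  (forall n, ((mu * o * N n) ^+ 2)%:C
               <= inner (Phi0 n) (O n ^+ 2 *m Phi0 n)) ->
  (forall n, inner (Phi0 n) (O n ^+ 3 *m Phi0 n) = 0) ->
  (exists (phi : nat -> nat) (omega : functional R d q),
     {homo phi : m n / (m < n)%N} /\
     vector_limit (fun n => Xi (phi n)) omega) /\
  (forall (phi : nat -> nat) (omega : functional R d q),
     {homo phi : m n / (m < n)%N} ->
     vector_limit (fun n => Xi (phi n)) omega ->
     [/\ infinite_volume_state omega,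
         translation_invariant omega,
         ground_state ho omega
       & ergodic omega]).
Proof.
move=> N H O Psi Xi d0 Loo fS hho hoo _ _ o0 EG0 mu0 _ _ E01 nd0 nd1 ev0 ev1 gap.
move=> O1 O2 O3.
(* Bounds of the two fixed matrices; by [embed_opbound] they hold on every torus where the supports
   fit. *)
have [c c0 hc] := opbound_ex ho; have [a a0 ha] := opbound_ex oo.
have m0 : 0 < mu * o by rewrite mulr_gt0.
split; first exact: (limit_exists Loo hoo m0 ev0 O1 O2).
move=> phi omega phi_incr lim_omega.
have phi_ge n : (n <= phi n)%N.
  by elim: n => // n ih; apply: leq_ltn_trans ih _; exact: phi_incr.
have phi_oo : phi n @[n --> \oo] --> \oo.
  move=> A [n0 _ hA]; exists n0 => // n /= n0n; apply: hA => /=.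
  exact: leq_trans n0n (phi_ge n).
(* All hypotheses are inherited by the reindexed family, so the limit is studied along [L'] as a
   full sequence. *)
pose L' n := L (phi n).
have Loo' : L' n @[n --> \oo] --> \oo := cvg_comp _ _ phi_oo Loo.
pose Phi0' n : vec R q (torus d (L' n)) := Phi0 (phi n).
pose Phi1' n : vec R q (torus d (L' n)) := Phi1 (phi n).
have nd0' n := nd0 (phi n); have nd1' n := nd1 (phi n).
have ev0' n : normalized_eigenstate (tau_sum (L' n) ho) (E0 (phi n)) (Phi0' n).
  exact: ev0.
have ev1' n : normalized_eigenstate (tau_sum (L' n) ho) (E1 (phi n)) (Phi1' n).
  exact: ev1.
have O1' n := O1 (phi n); have O2' n := O2 (phi n); have O3' n := O3 (phi n).
have E01' n := E01 (phi n); have gap' n := @gap (phi n).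
have fS' n : fits (L' n) S := fS (phi n).
split.
- exact: (limit_infinite_volume_state Loo' hoo m0 ev0' O1' O2' lim_omega).
- exact: (limit_translation_invariant Loo' nd0' ev0' lim_omega).
- exact: (limit_ground_state d0 Loo' fS' hho hoo c0 hc a0 ha EG0 m0 E01' nd0'
    ev0' gap' O1' O2' lim_omega).
- exact: (limit_ergodic d0 Loo' fS' hho hoo c0 hc a0 ha EG0 m0 E01' nd0' nd1'
    ev0' ev1' gap' O1' O2' O3' lim_omega).
Qed.
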